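(* Let $m\geq 1$ be any odd integer. Then $$\sum_{n=1}^{\infty}(-1)^{n+1}H_n\sum_{p=0}^{m-1}\left[\frac{(-1)^p}{3mn+3p+1}+\frac{(-1)^p}{3mn+3p+2}\right]=\frac{m}{12}\left(\psi'(5/6)-\psi'(1/3)\right)-\frac{\pi^2m}{9}+\frac{\pi\sqrt{3}}{3}\log 3-\frac{\pi(m-1)\sqrt{3}}{9}\log 2-\frac{2\pi\sqrt{3}}{9}\Bigg\{2\sum_{k=0}^{\frac{m-3}{2}}\log\left[\sin\left(\frac{1}{3}\sin^{-1}\sqrt{\frac{\varphi_k+1}{2}}\right)\right]-\sum_{k=0}^{\frac{m-3}{2}}\log \left[2 \cos \left(\frac{2}{3} \sin ^{-1}\sqrt{\frac{1+\varphi_k}{2}}\right)+1\right]-\sum_{k=0}^{\frac{m-3}{2}}\log\left(1+\varphi_k\right)\Bigg\}.$$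
   Context: $H_n=1+\frac12+\cdots+\frac1n$ is the $n$th harmonic number; $\psi=\Gamma'/\Gamma$ is the digamma function and $\psi'$ its derivative. For given $m$, $\varphi_k=\cos\left(\frac{(2k+1)\pi}{m}\right)$. $\sin^{-1}$ denotes the (principal) inverse sine. An empty sum $\sum_{k=0}^{-1}(\cdot)$ is taken to be zero. *)

(* Defs.v *)
From Stdlib Require Import Reals.
From Coquelicot Require Import Coquelicot.
Open Scope R_scope.

(** Sum of [f k] over [0 <= k < n].  An upper limit [N] in the usual notation
    corresponds to [n = N + 1], so that the upper limit [-1] gives the empty
    sum, without truncated subtraction. *)
Definition sum_lt (f : nat -> R) (n : nat) : R :=
  match n with
  | O => 0
  | S n' => sum_n f n'
  end.

(** [a 1 + a 2 + ...] converges (as a limit of partial sums, not necessarily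
    absolutely) to [l]; the value [a 0] is ignored. *)
Definition is_series_from1 (a : nat -> R) (l : R) : Prop :=
  is_series (fun j : nat => a (S j)) l.

Definition harmonic (n : nat) : R := sum_lt (fun k => / INR (S k)) n.

(** Euler's integral, meaningful for [x > 0] only. *)
Definition Gamma (x : R) : R :=
  RInt_gen (fun t => Rpower t (x - 1) * exp (- t))
    (at_right 0) (Rbar_locally p_infty).

Definition digamma (x : R) : R := Derive Gamma x / Gamma x.

Definition trigamma (x : R) : R := Derive digamma x.

Definition phi (m k : nat) : R := cos ((2 * INR k + 1) * PI / INR m).

(* Main.v *)
Require Import Defs.
From Stdlib Require Import Reals Lra Lia Arith Nsatz.
From Coquelicot Require Import Coquelicot.
Open Scope R_scope.

(** Write [c x = x^2 - x + 1 = (1 + x^3) / (1 + x)].  Since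
    [sum H_n (-y)^n = - ln (1 + y) / (1 + y)], the series is the integral over
    [[0, 1]] of [ln (1 + x^(3 m)) / c x].  The polynomial [1 + y^m] is the product of
    [1 + y] and of the [y^2 - 2 phi_k y + 1], and for [y = x^3] each of the latter is a product
    of three trinomials [x^2 + 2 x cos a + 1] with [a = t, 2 PI / 3 + t, 2 PI / 3 - t].
    The derivative in [a] of the integral of [ln (x^2 + 2 x cos a + 1) / c x] is not
    elementary, but its combination over the three angles is the derivative of
    [(2 PI / sqrt 3) ln (1 + 2 cos t)].  The value at [t = 0] is obtained radially, from
    [ln ((1 + u^3 x^3) (x^3 + u^3))] with [u] running from [0] to [1]; it brings in
    [K = sum (-1)^n (1 / (3 n + 1)^2 + 1 / (3 n + 2)^2)], which is expressed by
    [trigamma] through the residue classes modulo 6 of the series [sum 1 / n^2 = PI^2 / 6].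
    The series of [trigamma] comes from Euler's integral by the log-convexity
    argument of Bohr and Mollerup. *)

(** The terms of the series are of size [ln n / n], so the convergence is not absolute; each passage
    to the limit under an integral over [[0, 1]] is replaced by a pointwise error bound that is
    integrated. For a single angle the derivative is [(a - 2 c1 sin a) / (1 + 2 cos a)], with [c1]
    the integral of [1 / c]; the obstacle is the bare [a]. Over the three angles the coefficients of
    [t] add up to zero, and a logarithmic derivative is left. The radial path is the angular one
    continued to imaginary [t]: [(1 + u^3 x^3) (x^3 + u^3)] is
    [u^3 (x^6 + 2 cosh (3 ln u) x^3 + 1)], and [1 + 2 cosh (ln u)] is [(1 + u + u^2) / u]. It ends
    at [u = 0], where the integrand becomes [3 ln x / c x], with integral [-3 K]. [trigamma] is
    defined through [Derive] applied to an improper integral. Bohr-Mollerup yields a series for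
    [ln Gamma], which is differentiated term by term, so that no derivative is taken under the
    improper integral. *)

Lemma exp_le_exp (x y : R) : x <= y -> exp x <= exp y.
Proof.
  intros [H | ->]; [left; now apply exp_increasing | apply Rle_refl].
Qed.

Lemma Rabs_ball (x y e : R) : Rabs (y - x) < e -> ball x e y.
Proof. exact (fun H => H). Qed.

Lemma ball_Rabs (x y e : R) : ball x e y -> Rabs (y - x) < e.
Proof. exact (fun H => H). Qed.

Lemma ex_RInt_continuous_le (f : R -> R) (a b : R) :
  a <= b -> (forall x, a <= x <= b -> continuous f x) -> ex_RInt f a b.
Proof.
  intros Hab H. apply (ex_RInt_continuous (V := R_CompleteNormedModule)).
  rewrite Rmin_left, Rmax_right by lra. exact H.
Qed.

Lemma is_RInt_derive_le (f df : R -> R) (a b : R) :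
  a <= b -> (forall x, a <= x <= b -> is_derive f x (df x)) ->
  (forall x, a <= x <= b -> continuous df x) ->
  is_RInt df a b (f b - f a).
Proof.
  intros Hab H1 H2. apply (is_RInt_derive f df); rewrite Rmin_left, Rmax_right by lra; auto.
Qed.

Lemma RInt_correct_R (f : R -> R) (a b : R) : ex_RInt f a b -> is_RInt f a b (RInt f a b).
Proof. apply (RInt_correct (V := R_CompleteNormedModule)). Qed.

Lemma exp_mult_pos (a y : R) : 0 < y -> exp a * y = exp (a + ln y).
Proof. intros Hy. now rewrite exp_plus, exp_ln. Qed.

Lemma sum_n_0 (a : nat -> R) : sum_n a 0 = a 0%nat :> R.
Proof. exact (sum_O a). Qed.

Lemma sum_n_S (a : nat -> R) (n : nat) : sum_n a (S n) = sum_n a n + a (S n) :> R.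
Proof. exact (sum_Sn a n). Qed.

Lemma is_lim_seq_sum_n (a : nat -> R) (l : R) : is_series a l <-> is_lim_seq (sum_n a) l.
Proof. reflexivity. Qed.

Lemma is_series_ext_R (a b : nat -> R) (l : R) :
  (forall n, a n = b n) -> is_series a l -> is_series b l.
Proof. apply is_series_ext. Qed.

Lemma is_series_plus_R (a b : nat -> R) (la lb : R) :
  is_series a la -> is_series b lb -> is_series (fun n => a n + b n) (la + lb).
Proof. apply (is_series_plus (V := R_NormedModule)). Qed.

Lemma is_series_minus_R (a b : nat -> R) (la lb : R) :
  is_series a la -> is_series b lb -> is_series (fun n => a n - b n) (la - lb).
Proof. apply (is_series_minus (V := R_NormedModule)). Qed.

(** * Euler's integral *)

Lemma filter_prod_0_infty (P : R * R -> Prop) :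
  (forall a b, 0 < a -> a < 1 -> 1 < b -> P (a, b)) ->
  filter_prod (at_right 0) (Rbar_locally p_infty) P.
Proof.
  intros H.
  apply (Filter_prod _ _ _ (fun a => 0 < a < 1) (fun b => 1 < b)).
  - exists (mkposreal 1 Rlt_0_1). intros y Hy Hpos. apply ball_Rabs in Hy; cbn [pos] in Hy.
    apply Rabs_def2 in Hy. lra.
  - exists 1. auto.
  - intros a b Ha Hb. apply H; lra.
Qed.

(** For a nonnegative integrand the integral over [[a, b]] grows with the interval, so the supremum
    of these integrals is their limit. *)
Lemma ex_RInt_gen_nonneg_bounded (f : R -> R) (M : R) :
  (forall x, 0 < x -> continuous f x) ->
  (forall x, 0 < x -> 0 <= f x) ->
  (forall a b, 0 < a -> a < 1 -> 1 < b -> RInt f a b <= M) ->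
  ex_RInt_gen f (at_right 0) (Rbar_locally p_infty).
Proof.
  intros Hc Hp HM.
  assert (Hex : forall a b, 0 < a -> a <= b -> ex_RInt f a b).
  { intros a b Ha Hab. apply ex_RInt_continuous_le; auto. intros z Hz. apply Hc; lra. }
  set (E := fun y => exists a b, 0 < a /\ a < 1 /\ 1 < b /\ y = RInt f a b).
  destruct (completeness E) as [l [Hub Hlub]].
  - exists M. intros y (a & b & Ha & Ha1 & Hb & ->). now apply HM.
  - exists (RInt f (1/2) 2), (1/2), 2. repeat split; lra.
  - exists l. intros P [eps HP].
    destruct (Classical_Prop.classic (exists a b, 0 < a /\ a < 1 /\ 1 < b /\ l - eps < RInt f a b))
      as [(a0 & b0 & Ha0 & Ha1 & Hb0 & Hl)|Hno].
    (* Without such an interval, [l - eps] would be a smaller upper bound. *)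
    2:{ exfalso. assert (l <= l - eps); [|destruct eps; simpl in *; lra].
        apply Hlub. intros y (a & b & Ha & Ha1 & Hb & ->).
        apply Rnot_lt_le. intros Hlt. apply Hno. exists a, b. auto. }
    apply (Filter_prod _ _ _ (fun a => 0 < a < a0) (fun b => b0 < b)).
    + exists (mkposreal a0 Ha0). intros y Hy Hpos.
      apply ball_Rabs in Hy; cbn [pos] in Hy.
      apply Rabs_def2 in Hy. lra.
    + exists b0. auto.
    + intros a b Ha Hb. exists (RInt f a b). split.
      * apply RInt_correct_R. apply Hex; cbn [fst snd]; lra.
      * apply HP. apply Rabs_ball.
        assert (H1 : RInt f a b <= l).
        { apply Hub. exists a, b. repeat split; lra. }
        assert (H2 : RInt f a0 b0 <= RInt f a b).
        { rewrite <- (RInt_Chasles f a a0 b) by (apply Hex; lra).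
          rewrite <- (RInt_Chasles f a0 b0 b) by (apply Hex; lra).
          unfold plus; simpl.
          assert (0 <= RInt f a a0) by (apply RInt_ge_0; [lra|apply Hex; lra|intros; apply Hp; lra]).
          assert (0 <= RInt f b0 b) by (apply RInt_ge_0; [lra|apply Hex; lra|intros; apply Hp; lra]).
          lra. }
        apply Rabs_def1; lra.
Qed.

Definition gamma_integrand (x t : R) : R := Rpower t (x - 1) * exp (- t).

Lemma gamma_integrand_continuous (x t : R) : 0 < t -> continuous (gamma_integrand x) t.
Proof.
  intros Ht. apply (ex_derive_continuous (gamma_integrand x)). unfold gamma_integrand, Rpower.
  auto_derive. lra.
Qed.

Lemma gamma_integrand_pos (x t : R) : 0 < gamma_integrand x t.
Proof. apply Rmult_lt_0_compat; apply exp_pos. Qed.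

Lemma ln_le_sub1 (x : R) : 0 < x -> ln x <= x - 1.
Proof.
  intros Hx. pose proof (exp_ineq1_le (x - 1)).
  rewrite <- (ln_exp (x - 1)). apply ln_le; lra.
Qed.

(** The exponent is chosen so that [t^(x-1) (1+t)^(-(x+1))] has the primitive [(t/(1+t))^x / x]. The
    constant is the maximum of [(1+t)^(x+1) exp (-t)], reached at [t = x]. *)
Lemma exp_opp_le_Rpower (x : R) : 0 < x ->
  exists C, 0 < C /\ forall t, 0 < t -> exp (- t) <= C * Rpower (1 + t) (- (x + 1)).
Proof.
  intros Hx. exists (exp (1 - (x + 1) + (x + 1) * ln (x + 1))). split. apply exp_pos.
  intros t Ht. unfold Rpower. rewrite <- exp_plus.
  apply exp_le_exp.
  assert (H := ln_le_sub1 ((1 + t) / (x + 1)) ltac:(apply Rdiv_lt_0_compat; lra)).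
  unfold Rdiv in H. rewrite ln_mult, ln_Rinv in H; try lra.
  2:{ apply Rinv_0_lt_compat; lra. }
  apply (Rmult_le_compat_l (x + 1)) in H; [|lra].
  replace ((x + 1) * ((1 + t) * / (x + 1) - 1)) with (1 + t - (x + 1)) in H by (field; lra).
  lra.
Qed.

Lemma Gamma_ex (x : R) : 0 < x ->
  is_RInt_gen (gamma_integrand x) (at_right 0) (Rbar_locally p_infty) (Gamma x).
Proof.
  intros Hx. apply (RInt_gen_correct (V := R_CompleteNormedModule)).
  destruct (exp_opp_le_Rpower x Hx) as (C & HC & HCb).
  apply (ex_RInt_gen_nonneg_bounded _ (C * / x)).
  - intros; now apply gamma_integrand_continuous.
  - intros t _. apply Rlt_le, gamma_integrand_pos.
  - intros a b Ha Ha1 Hb.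
    (* [h] is [C / x] times the power [x] of [t / (1 + t)]; its values lie between 0 and [C / x],
       which bounds the integral for all [a] and [b]. *)
    set (h := fun t => C * / x * exp (x * (ln t - ln (1 + t)))).
    set (dh := fun t => C * (Rpower t (x - 1) * Rpower (1 + t) (- (x + 1)))).
    assert (Hd : forall t, 0 < t -> is_derive h t (dh t)).
    { intros t Ht. unfold h, dh, Rpower. auto_derive. lra.
      rewrite <- exp_plus.
      replace (exp (x * (ln t + - ln (1 + t)))) with
        (exp ((x - 1) * ln t + - (x + 1) * ln (1 + t)) * (t * (1 + t))).
      field; lra.
      rewrite <- Rmult_assoc, !exp_mult_pos by lra. f_equal. ring. }
    assert (Hi : is_RInt dh a b (h b - h a)).
    { apply is_RInt_derive_le; [lra| |]; intros t Ht.
      - apply Hd; lra.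
      - apply (ex_derive_continuous dh). unfold dh, Rpower. auto_derive. lra. }
    apply Rle_trans with (RInt dh a b).
    + apply RInt_le; [lra| |eexists; apply Hi|].
      * apply ex_RInt_continuous_le; [lra|]. intros t Ht.
        apply gamma_integrand_continuous; lra.
      * intros t Ht. unfold dh, gamma_integrand.
        assert (0 < Rpower t (x - 1)) by apply exp_pos.
        specialize (HCb t ltac:(lra)). nra.
    + rewrite (is_RInt_unique _ _ _ _ Hi).
      assert (0 < h a). { unfold h. assert (0 < / x) by (apply Rinv_0_lt_compat; lra).
        apply Rmult_lt_0_compat; [nra|apply exp_pos]. }
      assert (Hix : 0 < / x) by (apply Rinv_0_lt_compat; lra).
      assert (h b <= C * / x).
      { unfold h. rewrite <- (Rmult_1_r (C * / x)) at 2. apply Rmult_le_compat_l.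
        - nra.
        - apply Rle_trans with (exp 0); [apply exp_le_exp | rewrite exp_0; lra].
          assert (ln b < ln (1 + b)) by (apply ln_increasing; lra). nra. }
      lra.
Qed.

Lemma RInt_gen_unique_0_infty (f : R -> R) (l : R) :
  is_RInt_gen f (at_right 0) (Rbar_locally p_infty) l ->
  RInt_gen f (at_right 0) (Rbar_locally p_infty) = l.
Proof. apply (is_RInt_gen_unique (V := R_CompleteNormedModule)). Qed.

(** Integration by parts: [h t = t^x exp (-t)] tends to 0 at both ends. *)
Lemma Gamma_succ (x : R) : 0 < x -> Gamma (x + 1) = x * Gamma x.
Proof.
  intros Hx.
  set (h := fun t => Rpower t x * exp (- t)).
  assert (Hd : forall t, 0 < t -> is_derive h t (x * gamma_integrand x t - gamma_integrand (x + 1) t)).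
  { intros t Ht. unfold h, gamma_integrand, Rpower. auto_derive. lra.
    replace (x + 1 - 1) with x by ring.
    replace (exp (x * ln t)) with (exp ((x - 1) * ln t) * t)
      by (rewrite exp_mult_pos by lra; f_equal; ring).
    field. lra. }
  assert (Hi : is_RInt_gen (Derive h) (at_right 0) (Rbar_locally p_infty) (0 - 0)).
  { apply is_RInt_gen_Derive.
    - apply filter_prod_0_infty. intros a b Ha Ha1 Hb t. simpl. rewrite Rmin_left by lra.
      intros Ht. eexists. apply Hd; lra.
    - apply filter_prod_0_infty. intros a b Ha Ha1 Hb t. simpl. rewrite Rmin_left by lra.
      intros Ht.
      apply (continuous_ext_loc _ (fun t => x * gamma_integrand x t - gamma_integrand (x + 1) t)).
      + exists (mkposreal t ltac:(lra)). intros y Hy. symmetry. apply is_derive_unique, Hd.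
        apply ball_Rabs in Hy; cbn [pos] in Hy.
        apply Rabs_def2 in Hy. lra.
      + apply (continuous_minus (fun t => x * gamma_integrand x t)).
        * apply (continuous_scal_r x (gamma_integrand x)). apply gamma_integrand_continuous; lra.
        * apply gamma_integrand_continuous; lra.
    - intros P [eps HP].
      (* Near 0: [t < eps^(1/x)] makes [t^x < eps]. *)
      assert (Hr : 0 < Rpower eps (/ x)) by apply exp_pos.
      exists (mkposreal _ Hr). intros t Ht Htp. apply HP. apply ball_Rabs in Ht; cbn [pos] in Ht. apply Rabs_ball. rewrite Rminus_0_r in *.
      rewrite Rabs_pos_eq in Ht by lra.
      rewrite Rabs_pos_eq. 2:{ unfold h. assert (0 < Rpower t x * exp (-t)) by (apply Rmult_lt_0_compat; apply exp_pos). lra. }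
      unfold h.
      assert (Rpower t x < eps).
      { apply Rle_lt_trans with (Rpower t x). lra.
        replace (pos eps) with (Rpower (Rpower eps (/ x)) x).
        - apply Rlt_Rpower_l; [lra|lra].
        - rewrite Rpower_mult. replace (/ x * x) with 1 by (field; lra).
          apply Rpower_1. apply cond_pos. }
      assert (exp (- t) < 1) by (rewrite <- exp_0; apply exp_increasing; lra).
      assert (0 < Rpower t x) by apply exp_pos. nra.
    - destruct (exp_opp_le_Rpower x Hx) as (C & HC & HCb).
      (* Near infinity [h t <= C / (1 + t)], by the power bound on the exponential. *)
      intros P [eps HP]. exists (C / eps). intros t Ht.
      assert (0 < C / eps) by (apply Rdiv_lt_0_compat; [lra|apply cond_pos]).
      apply HP. apply Rabs_ball. rewrite Rminus_0_r.
      rewrite Rabs_pos_eq. 2:{ unfold h. assert (0 < Rpower t x * exp (-t)) by (apply Rmult_lt_0_compat; apply exp_pos). lra. }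
      unfold h.
      assert (H1 : Rpower t x * exp (- t) <= C * / (1 + t)).
      { specialize (HCb t ltac:(lra)).
        apply Rle_trans with (Rpower (1 + t) x * (C * Rpower (1 + t) (- (x + 1)))).
        - apply Rmult_le_compat; try (apply Rlt_le, exp_pos); auto.
          apply Rle_Rpower_l; lra.
        - rewrite (Rmult_comm C), <- Rmult_assoc, <- Rpower_plus.
          replace (x + - (x + 1)) with (- (1)) by ring.
          rewrite Rpower_Ropp, Rpower_1 by lra. lra. }
      assert (C * / (1 + t) < eps).
      { apply (Rmult_lt_reg_r (1 + t)). lra. rewrite Rmult_assoc, Rinv_l, Rmult_1_r by lra.
        apply (Rmult_lt_compat_r eps) in Ht; [|apply cond_pos].
        unfold Rdiv in Ht. rewrite Rmult_assoc, Rinv_l in Ht by (apply Rgt_not_eq, cond_pos).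
        pose proof (cond_pos eps). nra. }
      lra. }
  assert (Hs := is_RInt_gen_minus _ _ _ _ (is_RInt_gen_scal _ x _ (Gamma_ex x Hx)) (Gamma_ex (x + 1) ltac:(lra))).
  apply RInt_gen_unique_0_infty in Hs.
  apply (is_RInt_gen_ext _ (fun y : R => minus (scal x (gamma_integrand x y)) (gamma_integrand (x + 1) y))) in Hi.
  - apply RInt_gen_unique_0_infty in Hi.
    assert (E : x * Gamma x - Gamma (x + 1) = 0 - 0) by exact (eq_trans (eq_sym Hs) Hi). lra.
  - apply filter_prod_0_infty. intros a b Ha Ha1 Hb t. simpl. rewrite Rmin_left by lra.
    intros Ht. apply is_derive_unique, Hd. lra.
Qed.

Lemma Gamma_1 : Gamma 1 = 1.
Proof.
  apply (RInt_gen_unique_0_infty (gamma_integrand 1)).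
  replace 1 with (0 - - (1)) at 2 by ring.
  apply (is_RInt_gen_ext (Derive (fun t => - exp (- t)))).
  - apply filter_prod_0_infty. intros a b Ha Ha1 Hb t _.
    transitivity (exp (- t)).
    + apply is_derive_unique. auto_derive; auto. ring.
    + unfold gamma_integrand, Rpower. replace ((1 - 1) * ln t) with 0 by ring. rewrite exp_0. apply eq_sym, Rmult_1_l.
  - assert (Hd : forall t, is_derive (fun t => - exp (- t)) t (exp (- t))).
    { intros t. auto_derive; auto. ring. }
    apply is_RInt_gen_Derive.
    + apply filter_prod_0_infty. intros. eexists. apply Hd.
    + apply filter_prod_0_infty. intros.
      apply (continuous_ext (fun t => exp (- t))).
      * intros t. symmetry. now apply is_derive_unique.
      * apply (ex_derive_continuous (fun t => exp (- t))). auto_derive. auto.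
    + apply (filterlim_filter_le_1 (F := locally 0)); [apply filter_le_within|].
      assert (H : continuous (fun t => - exp (- t)) 0).
      { apply (ex_derive_continuous (fun t => - exp (- t))). auto_derive. auto. }
      unfold continuous in H. now rewrite Ropp_0, exp_0 in H.
    + change (is_lim (fun t => - exp (- t)) p_infty 0).
      replace (Finite 0) with (Rbar_opp 0) by (simpl; f_equal; ring).
      apply is_lim_opp. apply is_lim_comp with m_infty.
      * apply is_lim_exp_m.
      * replace m_infty with (Rbar_opp p_infty) by reflexivity. apply is_lim_opp, is_lim_id.
      * exists 0. easy.
Qed.

Lemma Gamma_le_lincomb (x y z a b : R) : 0 < x -> 0 < y -> 0 < z ->
  (forall t, 0 < t -> gamma_integrand x t <= a * gamma_integrand y t + b * gamma_integrand z t) ->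
  Gamma x <= a * Gamma y + b * Gamma z.
Proof.
  intros Hx Hy Hz H.
  assert (Hr := is_RInt_gen_plus _ _ _ _
    (is_RInt_gen_scal _ a _ (Gamma_ex y Hy)) (is_RInt_gen_scal _ b _ (Gamma_ex z Hz))).
  apply Rle_trans with (1 := Rle_abs _).
  apply (RInt_gen_norm (V := R_CompleteNormedModule) (gamma_integrand x) _ _ _) with (4 := Hr).
  - apply filter_prod_0_infty. simpl. intros. lra.
  - apply filter_prod_0_infty. intros c d Hc Hc1 Hd t Ht.
    change (Rabs (gamma_integrand x t) <= a * gamma_integrand y t + b * gamma_integrand z t).
    rewrite Rabs_pos_eq by (apply Rlt_le, gamma_integrand_pos).
    apply H. cbn [fst snd] in Ht. lra.
  - now apply Gamma_ex.
Qed.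

(** Weighted arithmetic-geometric inequality for [s] and 1. With [w] the weighted mean,
    [ln v <= v - 1] at [v = s / w] and at [v = 1 / w], averaged with the weights [x] and [1 - x],
    gives [x ln s <= ln w]. *)
Lemma Rpower_le_tangent (s x : R) : 0 < s -> 0 < x < 1 -> Rpower s x <= 1 - x + x * s.
Proof.
  intros Hs Hx.
  set (w := 1 - x + x * s). assert (Hw : 0 < w) by (unfold w; nra).
  assert (H1 := ln_le_sub1 (s / w) ltac:(apply Rdiv_lt_0_compat; lra)).
  assert (H2 := ln_le_sub1 (1 / w) ltac:(apply Rdiv_lt_0_compat; lra)).
  rewrite ln_div in H1, H2 by lra. rewrite ln_1 in H2.
  unfold Rpower. rewrite <- (exp_ln w Hw). apply exp_le_exp.
  assert (x * (s / w - 1) + (1 - x) * (1 / w - 1) = 0) by (unfold w in *; field; lra).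
  nra.
Qed.

(** The log-convexity bound [Gamma (y+x) <= Gamma (y)^(1-x) Gamma (y+1)^x], obtained pointwise:
    [t^x = y^x (t/y)^x] lies below its tangent at [t = y], and the functional equation collapses the
    integral of the tangent to [y^x Gamma y]. *)
Lemma Gamma_interp_upper (y x : R) : 0 < y -> 0 < x < 1 -> Gamma (y + x) <= Rpower y x * Gamma y.
Proof.
  intros Hy Hx.
  assert (H : Gamma (y + x) <= Rpower y x * (1 - x) * Gamma y + Rpower y x * (x / y) * Gamma (y + 1)).
  { apply Gamma_le_lincomb; try lra. intros t Ht. unfold gamma_integrand.
    assert (Hr := Rpower_le_tangent (t / y) x ltac:(apply Rdiv_lt_0_compat; lra) Hx).
    replace (y + x - 1) with ((y - 1) + x) by ring.
    replace (y + 1 - 1) with ((y - 1) + 1) by ring.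
    rewrite !Rpower_plus, Rpower_1 by lra.
    replace (Rpower t x) with (Rpower y x * Rpower (t / y) x).
    2:{ rewrite Rpower_mult_distr by (try apply Rdiv_lt_0_compat; lra).
        f_equal. field. lra. }
    assert (0 < Rpower t (y - 1) * exp (- t) * Rpower y x).
    { repeat apply Rmult_lt_0_compat; apply exp_pos. }
    apply Rle_trans with (Rpower t (y - 1) * exp (- t) * Rpower y x * (1 - x + x * (t / y))).
    - apply Rle_trans with (Rpower t (y - 1) * exp (- t) * Rpower y x * Rpower (t / y) x); [right; ring|].
      apply Rmult_le_compat_l; lra.
    - right. field. lra. }
  rewrite Gamma_succ in H by lra.
  replace (Rpower y x * Gamma y) with (Rpower y x * (1 - x) * Gamma y + Rpower y x * (x / y) * (y * Gamma y)) by (field; lra).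
  exact H.
Qed.

Lemma Gamma_INR (n : nat) : Gamma (INR n + 1) = INR (fact n).
Proof.
  induction n as [|n IH].
  - simpl. rewrite Rplus_0_l. apply Gamma_1.
  - rewrite S_INR, Gamma_succ by (pose proof (pos_INR n); lra). rewrite IH, fact_simpl, mult_INR, S_INR. ring.
Qed.

(** * The Basel series *)

Definition cos_moment (j n : nat) : R := RInt (fun x => x ^ j * cos x ^ (2 * n)) 0 (PI / 2).

Lemma cos_moment_correct (j n : nat) :
  is_RInt (fun x => x ^ j * cos x ^ (2 * n)) 0 (PI / 2) (cos_moment j n).
Proof.
  pose proof PI_RGT_0. apply RInt_correct_R, ex_RInt_continuous_le; [lra|].
  intros x _. apply (ex_derive_continuous (fun x => x ^ j * cos x ^ (2 * n))).
  auto_derive. auto.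
Qed.

Lemma cos_moment_0_pos (n : nat) : 0 < cos_moment 0 n.
Proof.
  pose proof PI_RGT_0. apply RInt_gt_0; [lra| |].
  - intros x Hx. rewrite Rmult_1_l. apply pow_lt, cos_gt_0; lra.
  - intros x _.
    apply (ex_derive_continuous (fun x => x ^ 0 * cos x ^ (2 * n))). auto_derive. auto.
Qed.

(** Wallis recursion, from the derivative of [sin x cos^(2n+1) x], which vanishes at both ends. *)
Lemma cos_moment_0_succ (n : nat) :
  (2 * INR n + 2) * cos_moment 0 (S n) = (2 * INR n + 1) * cos_moment 0 n.
Proof.
  pose proof PI_RGT_0.
  set (F := fun x => sin x * cos x ^ S (2 * n)).
  assert (H1 : is_RInt (fun x => (2 * INR n + 2) * (x ^ 0 * cos x ^ (2 * S n)) - (2 * INR n + 1) * (x ^ 0 * cos x ^ (2 * n))) 0 (PI / 2) (F (PI / 2) - F 0)).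
  { apply is_RInt_derive_le; [lra| |]; intros x _.
    - unfold F; clear F. replace (2 * S n)%nat with (S (S (2 * n))) by lia.
      assert (He : INR (2 * n) = 2 * INR n) by (rewrite mult_INR; simpl; ring).
      (* The exponent becomes a variable so that it is not unfolded; the [match] left by
         [auto_derive] is then [INR (S e)]. *)
      generalize dependent (2 * n)%nat. intros e He.
      auto_derive. auto.
      change (match e with 0%nat => 1 | S _ => INR e + 1 end) with (INR (S e)).
      rewrite S_INR, He. pose proof (sin2_cos2 x) as Hsc. unfold Rsqr in Hsc.
      simpl pow. generalize dependent (cos x ^ e). intros p.
      replace (sin x * (1 * - sin x * ((2 * INR n + 1) * p)))
        with (- (sin x * sin x) * ((2 * INR n + 1) * p)) by ring.
      replace (sin x * sin x) with (1 - cos x * cos x) by lra.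
      ring.
    - apply (ex_derive_continuous (fun x => (2 * INR n + 2) * (x ^ 0 * cos x ^ (2 * S n)) - (2 * INR n + 1) * (x ^ 0 * cos x ^ (2 * n)))).
      auto_derive. auto. }
  assert (H2 := is_RInt_minus _ _ _ _ _ _ (is_RInt_scal _ _ _ (2 * INR n + 2) _ (cos_moment_correct 0 (S n)))
     (is_RInt_scal _ _ _ (2 * INR n + 1) _ (cos_moment_correct 0 n))).
  apply (is_RInt_unique (V := R_CompleteNormedModule)) in H1, H2.
  assert (H3 : (2 * INR n + 2) * cos_moment 0 (S n) - (2 * INR n + 1) * cos_moment 0 n =
    F (PI / 2) - F 0) by exact (eq_trans (eq_sym H2) H1).
  unfold F in H3. rewrite cos_PI2, sin_0, pow_ne_zero in H3 by lia. lra.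
Qed.

(** Two integrations by parts of the Wallis integral merged into one primitive: [F] is the sum of
    the two boundary terms and vanishes at 0 and [PI / 2]. *)
Lemma cos_moment_2_succ (n : nat) :
  cos_moment 0 (S n) =
  (INR n + 1) * (2 * INR n + 1) * cos_moment 2 n - 2 * (INR n + 1) ^ 2 * cos_moment 2 (S n).
Proof.
  pose proof PI_RGT_0.
  set (F := fun x => x * (cos x * cos x ^ S (2 * n)) + (INR n + 1) * x ^ 2 * sin x * cos x ^ S (2 * n)).
  set (f := fun x => x ^ 0 * cos x ^ (2 * S n) + (2 * (INR n + 1) ^ 2 * (x ^ 2 * cos x ^ (2 * S n))
     - (INR n + 1) * (2 * INR n + 1) * (x ^ 2 * cos x ^ (2 * n)))).
  assert (H1 : is_RInt f 0 (PI / 2) (F (PI / 2) - F 0)).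
  { apply is_RInt_derive_le; [lra| |]; intros x _.
    - unfold F, f; clear F f. replace (2 * S n)%nat with (S (S (2 * n))) by lia.
      assert (He : INR (2 * n) = 2 * INR n) by (rewrite mult_INR; simpl; ring).
      generalize dependent (2 * n)%nat. intros e He.
      auto_derive. auto.
      change (match e with 0%nat => 1 | S _ => INR e + 1 end) with (INR (S e)).
      rewrite S_INR, He. pose proof (sin2_cos2 x) as Hsc. unfold Rsqr in Hsc.
      simpl pow. generalize dependent (cos x ^ e). intros p.
      apply Rminus_diag_uniq.
      transitivity ((INR n + 1) * (2 * INR n + 1) * x ^ 2 * p * (1 - (sin x * sin x + cos x * cos x))); [ring|].
      rewrite Hsc. ring.
    - apply (ex_derive_continuous f). unfold f. auto_derive. auto. }
  assert (H2 := is_RInt_plus _ _ _ _ _ _ (cos_moment_correct 0 (S n))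
     (is_RInt_minus _ _ _ _ _ _ (is_RInt_scal _ _ _ (2 * (INR n + 1) ^ 2) _ (cos_moment_correct 2 (S n)))
     (is_RInt_scal _ _ _ ((INR n + 1) * (2 * INR n + 1)) _ (cos_moment_correct 2 n)))).
  apply (is_RInt_unique (V := R_CompleteNormedModule)) in H1, H2.
  assert (H3 : cos_moment 0 (S n) + (2 * (INR n + 1) ^ 2 * cos_moment 2 (S n)
      - (INR n + 1) * (2 * INR n + 1) * cos_moment 2 n) =
    F (PI / 2) - F 0) by exact (eq_trans (eq_sym H2) H1).
  unfold F in H3. rewrite cos_PI2, sin_0, pow_ne_zero in H3 by lia. lra.
Qed.

(** This is [x <= tan x] multiplied by [cos x], so that it makes sense at [PI / 2]. *)
Lemma x_cos_le_sin (x : R) : 0 <= x <= PI / 2 -> 0 <= x * cos x <= sin x.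
Proof.
  intros Hx. pose proof PI_RGT_0.
  split. { apply Rmult_le_pos; [lra|]. apply cos_ge_0; lra. }
  destruct (MVT_gen (fun t => sin t - t * cos t) 0 x (fun t => t * sin t)) as (c & Hc & E).
  - intros t _. auto_derive. auto. ring.
  - intros t _. apply continuity_pt_filterlim.
    apply (ex_derive_continuous (fun t => sin t - t * cos t)). auto_derive. auto.
  - rewrite Rmin_left, Rmax_right in Hc by lra.
    rewrite sin_0 in E.
    assert (0 <= sin c) by (apply sin_ge_0; lra).
    assert (0 <= c * sin c * (x - 0)) by (apply Rmult_le_pos; [apply Rmult_le_pos; lra | lra]).
    lra.
Qed.

(** The inequality [x cos x <= sin x] is squared and multiplied by [cos^(2n) x]. By the Wallis
    recursion the upper bound is [cos_moment 0 (S n) / (2n+1)], so the remainder of the telescoping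
    sum tends to 0. *)
Lemma cos_moment_2_bound (n : nat) :
  0 <= cos_moment 2 (S n) <= cos_moment 0 n - cos_moment 0 (S n).
Proof.
  pose proof PI_RGT_0.
  assert (Hm := is_RInt_minus _ _ _ _ _ _ (cos_moment_correct 0 n) (cos_moment_correct 0 (S n))).
  split.
  - apply (is_RInt_ge_0 (fun x => x ^ 2 * cos x ^ (2 * S n)) 0 (PI / 2)); [lra| apply cos_moment_correct|].
    intros x Hx. rewrite pow_mult. apply Rmult_le_pos; [apply pow2_ge_0|]. apply pow_le, pow2_ge_0.
  - apply (is_RInt_le (fun x => x ^ 2 * cos x ^ (2 * S n))
       (fun x => minus (x ^ 0 * cos x ^ (2 * n)) (x ^ 0 * cos x ^ (2 * S n))) 0 (PI / 2));
      [lra|apply cos_moment_correct|exact Hm|].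
    intros x Hx. unfold minus, plus, opp; simpl (Rplus _ _).
    replace (2 * S n)%nat with (2 + 2 * n)%nat by lia. rewrite pow_add.
    assert (0 <= cos x ^ (2 * n)) by (rewrite pow_mult; apply pow_le, pow2_ge_0).
    pose proof (x_cos_le_sin x ltac:(lra)) as Hs.
    pose proof (sin2_cos2 x) as Hsc. unfold Rsqr in Hsc.
    assert ((x * cos x) ^ 2 <= sin x ^ 2) by (apply pow_incr; exact Hs).
    change (x ^ 2 * (cos x ^ 2 * cos x ^ (2 * n)) <= x ^ 0 * cos x ^ (2 * n) + - (x ^ 0 * (cos x ^ 2 * cos x ^ (2 * n)))).
    replace (x ^ 0 * cos x ^ (2 * n) + - (x ^ 0 * (cos x ^ 2 * cos x ^ (2 * n)))) with ((sin x * sin x) * cos x ^ (2 * n)).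
    2:{ replace (sin x * sin x) with (1 - cos x * cos x) by lra. simpl. ring. }
    replace (x ^ 2 * (cos x ^ 2 * cos x ^ (2 * n))) with ((x * cos x) ^ 2 * cos x ^ (2 * n)) by ring.
    apply Rmult_le_compat_r; [auto|]. simpl in *; lra.
Qed.

(** [cos_moment_2_succ] divided by [(n+1)^2 cos_moment 0 (S n)]; the Wallis recursion moves the
    denominator of the first quotient to index [n]. *)
Lemma inv_square_telescope (n : nat) :
  / INR (S n) ^ 2 = 2 * (cos_moment 2 n / cos_moment 0 n) - 2 * (cos_moment 2 (S n) / cos_moment 0 (S n)).
Proof.
  pose proof (cos_moment_0_pos n). pose proof (cos_moment_0_pos (S n)).
  pose proof (cos_moment_0_succ n) as H1. pose proof (cos_moment_2_succ n) as H2.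
  pose proof (pos_INR n). rewrite S_INR.
  assert (E : cos_moment 0 n = (2 * INR n + 2) * cos_moment 0 (S n) / (2 * INR n + 1)).
  { rewrite H1. field. lra. }
  rewrite E.
  apply (Rmult_eq_reg_r ((INR n + 1) ^ 2 * cos_moment 0 (S n))).
  2:{ apply Rgt_not_eq, Rmult_lt_0_compat; auto. apply pow_lt; lra. }
  replace (/ (INR n + 1) ^ 2 * ((INR n + 1) ^ 2 * cos_moment 0 (S n))) with (cos_moment 0 (S n)) by (field; lra).
  rewrite H2 at 1. field. lra.
Qed.

Lemma cos_moment_0_0 : cos_moment 0 0 = PI / 2.
Proof.
  unfold cos_moment. rewrite (RInt_ext _ (fun _ => 1)) by (intros; simpl; ring).
  rewrite RInt_const. unfold scal; simpl; unfold mult; simpl. ring.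
Qed.

Lemma cos_moment_2_0 : cos_moment 2 0 = PI ^ 3 / 24.
Proof.
  pose proof PI_RGT_0.
  assert (H1 : is_RInt (fun x => x ^ 2 * cos x ^ (2 * 0)) 0 (PI / 2) ((PI / 2) ^ 3 / 3 - 0 ^ 3 / 3)).
  { apply (is_RInt_derive_le (fun x => x ^ 3 / 3)); [lra| |]; intros x _.
    - auto_derive. auto. simpl. field.
    - apply (ex_derive_continuous (fun x => x ^ 2 * cos x ^ (2 * 0))). auto_derive. auto. }
  unfold cos_moment. rewrite (is_RInt_unique _ _ _ _ H1). field.
Qed.

Lemma is_lim_seq_inv_linear (a b : R) : 0 < a -> is_lim_seq (fun n => / (a * INR n + b)) 0.
Proof.
  intros Ha. change (Finite 0) with (Rbar_inv p_infty).
  apply is_lim_seq_inv; [|easy].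
  apply is_lim_seq_plus with p_infty b.
  - replace p_infty with (Rbar_mult a p_infty).
    + apply is_lim_seq_scal_l, is_lim_seq_INR.
    + simpl. destruct (Rle_dec 0 a); [|lra]. destruct (Rle_lt_or_eq_dec 0 a r); [easy|lra].
  - apply is_lim_seq_const.
  - easy.
Qed.

(* Daners' elementary proof: [1/n^2] is the telescoping difference of
   [2 * (integral of x^2 cos^(2n)) / (integral of cos^(2n))]. *)
Theorem basel : is_series (fun n => / INR (S n) ^ 2) (PI ^ 2 / 6).
Proof.
  assert (Hs : forall n, sum_n (fun n => / INR (S n) ^ 2) n =
     PI ^ 2 / 6 - 2 * (cos_moment 2 (S n) / cos_moment 0 (S n)) :> R).
  { induction n as [|n IH].
    - rewrite sum_n_0, inv_square_telescope, cos_moment_0_0, cos_moment_2_0. pose proof PI_RGT_0.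
      pose proof (cos_moment_0_pos 1). field. split; lra.
    - rewrite sum_n_S, IH, inv_square_telescope. ring. }
  change (is_lim_seq (sum_n (fun n => / INR (S n) ^ 2)) (PI ^ 2 / 6)).
  apply is_lim_seq_ext with (fun n => PI ^ 2 / 6 - 2 * (cos_moment 2 (S n) / cos_moment 0 (S n))).
  { intros n. now rewrite Hs. }
  replace (Finite (PI ^ 2 / 6)) with (Finite (PI ^ 2 / 6 - 2 * 0)) by (f_equal; ring).
  apply is_lim_seq_minus'; [apply is_lim_seq_const|].
  apply (is_lim_seq_scal_l _ 2 0).
  apply is_lim_seq_le_le with (fun _ => 0) (fun n => / (2 * INR n + 1)).
  - intros n. pose proof (cos_moment_0_pos (S n)). pose proof (cos_moment_2_bound n).
    pose proof (cos_moment_0_succ n). pose proof (pos_INR n). split.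
    + apply Rmult_le_pos; [lra|]. apply Rlt_le, Rinv_0_lt_compat; lra.
    + apply (Rmult_le_reg_r (cos_moment 0 (S n) * (2 * INR n + 1))).
      * apply Rmult_lt_0_compat; lra.
      * replace (cos_moment 2 (S n) / cos_moment 0 (S n) * (cos_moment 0 (S n) * (2 * INR n + 1)))
          with ((2 * INR n + 1) * cos_moment 2 (S n)) by (field; lra).
        replace (/ (2 * INR n + 1) * (cos_moment 0 (S n) * (2 * INR n + 1))) with (cos_moment 0 (S n)) by (field; lra).
        nra.
  - apply is_lim_seq_const.
  - apply is_lim_seq_inv_linear. lra.
Qed.

(** * The series of the trigamma function *)

(** Remainders bounded by [c k (y-x)^2] term by term sum to a remainder bounded by [C (y-x)^2],
    which is differentiability at [x]. *)
Lemma is_derive_Series (g g' : nat -> R -> R) (c : nat -> R) (x d : R) :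
  0 < d ->
  (forall y, Rabs (y - x) < d -> ex_series (fun k => g k y)) ->
  ex_series (fun k => g' k x) ->
  ex_series c ->
  (forall k y, Rabs (y - x) < d ->
     Rabs (g k y - g k x - (y - x) * g' k x) <= c k * (y - x) ^ 2) ->
  is_derive (fun y => Series (fun k => g k y)) x (Series (fun k => g' k x)).
Proof.
  intros Hd Hg Hg' Hc Hq. apply is_derive_Reals. intros eps Heps.
  set (C := Series c).
  assert (Hb : forall y, Rabs (y - x) < d ->
    Rabs (Series (fun k => g k y) - Series (fun k => g k x) - (y - x) * Series (fun k => g' k x))
      <= C * (y - x) ^ 2).
  { intros y Hy.
    assert (Hx : ex_series (fun k => g k x)).
    { apply Hg. now rewrite Rminus_diag, Rabs_R0. }
    rewrite <- Series_scal_l, <- !Series_minus by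
      (try apply (ex_series_minus (V := R_NormedModule)); try apply (ex_series_scal (V := R_NormedModule)); auto).
    unfold C. rewrite <- Series_scal_r.
    assert (Hcy : ex_series (fun k => c k * (y - x) ^ 2)) by (apply ex_series_scal_r; auto).
    eapply Rle_trans.
    - apply Series_Rabs.
      apply (ex_series_le (K := R_AbsRing) (V := R_CompleteNormedModule)) with (fun k => c k * (y - x) ^ 2); auto.
      intros k. change (norm ?z) with (Rabs z). rewrite Rabs_Rabsolu. auto.
    - apply Series_le; auto. intros k. split; [apply Rabs_pos|auto]. }
  (* The sign of [C] is read off the summed inequality at [x + d / 2], whose left side is an
     absolute value. *)
  assert (HC : 0 <= C).
  { specialize (Hb (x + d / 2)). replace (x + d / 2 - x) with (d / 2) in Hb by ring.
    assert (Hd2 : Rabs (d / 2) < d) by (rewrite Rabs_pos_eq; lra).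
    apply (Rmult_le_reg_r ((d / 2) ^ 2)). apply pow_lt; lra.
    rewrite Rmult_0_l. eapply Rle_trans; [apply Rabs_pos|apply Hb, Hd2]. }
  assert (Hdel : 0 < Rmin d (eps / (C + 1))).
  { apply Rmin_pos; [auto|]. apply Rdiv_lt_0_compat; lra. }
  exists (mkposreal _ Hdel). intros h Hh Hhd. cbn [pos] in Hhd.
  assert (Hh1 : Rabs h < d) by (eapply Rlt_le_trans; [apply Hhd|apply Rmin_l]).
  assert (Hh2 : Rabs h < eps / (C + 1)) by (eapply Rlt_le_trans; [apply Hhd|apply Rmin_r]).
  specialize (Hb (x + h)). replace (x + h - x) with h in Hb by ring. specialize (Hb Hh1).
  assert (Hp : 0 < Rabs h) by now apply Rabs_pos_lt.
  apply (Rmult_lt_reg_r (Rabs h)); [auto|]. rewrite <- Rabs_mult.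
  replace (((Series (fun k => g k (x + h)) - Series (fun k => g k x)) / h - Series (fun k => g' k x)) * h)
    with (Series (fun k => g k (x + h)) - Series (fun k => g k x) - h * Series (fun k => g' k x)) by (field; auto).
  apply Rle_lt_trans with (1 := Hb).
  replace (h ^ 2) with (Rabs h * Rabs h) by (rewrite <- Rabs_mult, Rabs_pos_eq by nra; ring).
  rewrite <- Rmult_assoc. apply Rmult_lt_compat_r; [auto|].
  apply (Rmult_lt_compat_r (C + 1)) in Hh2; [|lra].
  unfold Rdiv in Hh2. rewrite Rmult_assoc, Rinv_l, Rmult_1_r in Hh2 by lra. nra.
Qed.

(** Interpolation from [n + 1 + x] up to [n + 2] bounds the factorial of [n + 1] by a positive
    multiple of [Gamma (n + 1 + x)]. *)
Lemma Gamma_pos_shift (n : nat) (x : R) : 0 < x < 1 -> 0 < Gamma (INR n + 1 + x).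
Proof.
  intros Hx. pose proof (pos_INR n).
  pose proof (Gamma_interp_upper (INR n + 1 + x) (1 - x) ltac:(lra) ltac:(lra)) as Hi.
  replace (INR n + 1 + x + (1 - x)) with (INR (S n) + 1) in Hi by (rewrite S_INR; ring).
  rewrite Gamma_INR in Hi.
  assert (0 < INR (fact (S n))) by (apply lt_0_INR, lt_O_fact).
  assert (0 < Rpower (INR n + 1 + x) (1 - x)) by apply exp_pos.
  apply Rnot_le_lt. intros Hn. nra.
Qed.

(** Logarithm of the factor [(1 + 1/n)^x / (1 + x/n)], [n = k + 1], of Euler's product for
    [Gamma (1 + x)]. *)
Definition ln_gamma_term (k : nat) (x : R) : R := x * ln (1 + / INR (S k)) - ln (1 + x / INR (S k)).

(** The functional equation telescopes the partial sums to [ln (Gamma (1 + x)) + r n]. Interpolation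
    with [y = n + 2], once from [y] and once from [y + x], confines [r n] to [[0, 1 / y]]. *)
Lemma is_series_ln_gamma (x : R) : 0 < x < 1 ->
  is_series (fun k => ln_gamma_term k x) (ln (Gamma (1 + x))).
Proof.
  intros Hx.
  set (r := fun n => x * ln (INR n + 2) + ln (Gamma (INR n + 2)) - ln (Gamma (INR n + 2 + x))).
  assert (Hpos : forall n, 0 < Gamma (INR n + 2)).
  { intros n. replace (INR n + 2) with (INR (S n) + 1) by (rewrite S_INR; ring).
    rewrite Gamma_INR. apply lt_0_INR, lt_O_fact. }
  assert (Hposx : forall n, 0 < Gamma (INR n + 2 + x)).
  { intros n. replace (INR n + 2) with (INR (S n) + 1) by (rewrite S_INR; ring).
    now apply Gamma_pos_shift. }
  assert (H1x : 0 < Gamma (1 + x)).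
  { replace (1 + x) with (INR 0 + 1 + x) by (simpl; ring). now apply Gamma_pos_shift. }
  assert (Hs : forall n, sum_n (fun k => ln_gamma_term k x) n = ln (Gamma (1 + x)) + r n :> R).
  { induction n as [|n IH].
    - rewrite sum_n_0. unfold ln_gamma_term, r.
      replace (Gamma (INR 0 + 2)) with 1.
      2:{ replace (INR 0 + 2) with (1 + 1) by (simpl; ring). rewrite Gamma_succ, Gamma_1 by lra. ring. }
      replace (INR 0 + 2 + x) with ((1 + x) + 1) by (simpl; ring).
      rewrite Gamma_succ, ln_mult, ln_1 by lra. simpl.
      replace (1 + / 1) with 2 by field. replace (1 + x / 1) with (1 + x) by field.
      rewrite Rplus_0_l. ring.
    - rewrite sum_n_S, IH. unfold ln_gamma_term, r. rewrite !S_INR. pose proof (pos_INR n).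
      specialize (Hpos n). specialize (Hposx n).
      replace (Gamma (INR n + 1 + 2)) with ((INR n + 2) * Gamma (INR n + 2)).
      2:{ rewrite <- Gamma_succ by lra. f_equal. ring. }
      replace (Gamma (INR n + 1 + 2 + x)) with ((INR n + 2 + x) * Gamma (INR n + 2 + x)).
      2:{ rewrite <- Gamma_succ by lra. f_equal. ring. }
      rewrite !ln_mult by lra.
      replace (1 + / (INR n + 1 + 1)) with ((INR n + 1 + 2) / (INR n + 2)) by (field; lra).
      replace (1 + x / (INR n + 1 + 1)) with ((INR n + 2 + x) / (INR n + 2)) by (field; lra).
      rewrite !ln_div by lra. ring. }
  apply is_lim_seq_sum_n. apply is_lim_seq_ext with (fun n => ln (Gamma (1 + x)) + r n).
  { intros n. now rewrite Hs. }
  replace (ln (Gamma (1 + x))) with (ln (Gamma (1 + x)) + 0) at 1 by ring.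
  apply is_lim_seq_plus'; [apply is_lim_seq_const|].
  apply is_lim_seq_le_le with (fun _ => 0) (fun n => / (1 * INR n + 2)).
  - intros n. specialize (Hpos n). specialize (Hposx n). unfold r. pose proof (pos_INR n).
    set (y := INR n + 2) in *. replace (1 * INR n + 2) with y by (unfold y; ring).
    assert (Hy : 0 < y) by (unfold y; lra). split.
    + pose proof (Gamma_interp_upper y x Hy Hx) as Hi.
      apply ln_le in Hi; auto.
      rewrite ln_mult in Hi by (auto; apply exp_pos). unfold Rpower in Hi. rewrite ln_exp in Hi. lra.
    (* [Gamma (y+1) <= (y+x)^(1-x) Gamma (y+x)] gives [r n <= (1-x) ln ((y+x)/y) <= (1-x) x / y]. *)
    + pose proof (Gamma_interp_upper (y + x) (1 - x) ltac:(lra) ltac:(lra)) as Hi.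
      replace (y + x + (1 - x)) with (y + 1) in Hi by ring.
      rewrite Gamma_succ in Hi by lra. apply ln_le in Hi.
      2:{ apply Rmult_lt_0_compat; auto. }
      rewrite !ln_mult in Hi by (auto; apply exp_pos). unfold Rpower in Hi. rewrite ln_exp in Hi.
      pose proof (ln_le_sub1 ((y + x) / y) ltac:(apply Rdiv_lt_0_compat; lra)) as Hl.
      rewrite ln_div in Hl by lra.
      replace ((y + x) / y - 1) with (x * / y) in Hl by (field; lra).
      assert (0 < / y) by now apply Rinv_0_lt_compat.
      assert ((1 - x) * (ln (y + x) - ln y) <= (1 - x) * (x * / y)) by (apply Rmult_le_compat_l; lra).
      assert ((1 - x) * (x * / y) <= / y) by (rewrite <- Rmult_assoc; assert ((1 - x) * x <= 1) by nra; nra).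
      lra.
  - apply is_lim_seq_const.
  - apply is_lim_seq_inv_linear. lra.
Qed.

(** Only [(y-x)/(n+x) - ln ((n+y)/(n+x))] survives, with [n = k + 1]. Two uses of [ln v <= v - 1],
    at this quotient and at its inverse, place it between 0 and [(y-x)^2 / ((n+x)(n+y))]. *)
Lemma ln_gamma_term_quadratic (k : nat) (x y : R) : 0 < x -> 0 < y ->
  Rabs (ln_gamma_term k y - ln_gamma_term k x - (y - x) * (ln (1 + / INR (S k)) - / (INR (S k) + x)))
    <= / INR (S k) ^ 2 * (y - x) ^ 2.
Proof.
  intros Hx Hy. unfold ln_gamma_term. assert (Hk : 0 < INR (S k)) by (apply lt_0_INR; lia).
  set (n := INR (S k)) in *.
  assert (0 < / n) by now apply Rinv_0_lt_compat.
  replace (1 + y / n) with ((n + y) / n) by (field; lra).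
  replace (1 + x / n) with ((n + x) / n) by (field; lra).
  rewrite !ln_div by lra.
  replace (y * ln (1 + / n) - (ln (n + y) - ln n) - (x * ln (1 + / n) - (ln (n + x) - ln n)) -
    (y - x) * (ln (1 + / n) - / (n + x))) with ((y - x) / (n + x) - (ln (n + y) - ln (n + x))) by (field; lra).
  pose proof (ln_le_sub1 ((n + y) / (n + x)) ltac:(apply Rdiv_lt_0_compat; lra)) as H1.
  pose proof (ln_le_sub1 ((n + x) / (n + y)) ltac:(apply Rdiv_lt_0_compat; lra)) as H2.
  rewrite ln_div in H1, H2 by lra.
  replace ((n + y) / (n + x) - 1) with ((y - x) / (n + x)) in H1 by (field; lra).
  replace ((n + x) / (n + y) - 1) with (- ((y - x) / (n + y))) in H2 by (field; lra).
  rewrite Rabs_pos_eq by lra.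
  apply Rle_trans with ((y - x) / (n + x) - (y - x) / (n + y)); [lra|].
  replace ((y - x) / (n + x) - (y - x) / (n + y)) with (/ ((n + x) * (n + y)) * (y - x) ^ 2) by (field; lra).
  apply Rmult_le_compat_r; [apply pow2_ge_0|].
  apply Rinv_le_contravar; [apply pow_lt; auto|]. nra.
Qed.

Lemma ln_gamma_deriv_term_quadratic (k : nat) (a x y : R) : 0 < x -> 0 < y ->
  Rabs ((a - / (INR (S k) + y)) - (a - / (INR (S k) + x)) - (y - x) * / (INR (S k) + x) ^ 2)
    <= / INR (S k) ^ 2 * (y - x) ^ 2.
Proof.
  intros Hx Hy. assert (Hk : 1 <= INR (S k)) by (rewrite S_INR; pose proof (pos_INR k); lra).
  set (n := INR (S k)) in *.
  replace (a - / (n + y) - (a - / (n + x)) - (y - x) * / (n + x) ^ 2)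
    with (- (/ ((n + x) ^ 2 * (n + y)) * (y - x) ^ 2)) by (field; lra).
  rewrite Rabs_Ropp, Rabs_pos_eq.
  2:{ apply Rmult_le_pos; [|apply pow2_ge_0]. apply Rlt_le, Rinv_0_lt_compat.
      apply Rmult_lt_0_compat; [apply pow_lt|]; lra. }
  apply Rmult_le_compat_r; [apply pow2_ge_0|].
  apply Rinv_le_contravar; [apply pow_lt; lra|].
  assert (n ^ 2 <= (n + x) ^ 2) by (apply pow_incr; lra).
  assert (0 < n ^ 2) by (apply pow_lt; lra). nra.
Qed.

Lemma ex_series_inv_square : ex_series (fun k => / INR (S k) ^ 2).
Proof. eexists. apply basel. Qed.

Lemma ex_series_inv_square_shift (x : R) : 0 <= x -> ex_series (fun k => / (INR (S k) + x) ^ 2).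
Proof.
  intros Hx.
  apply (ex_series_le (K := R_AbsRing) (V := R_CompleteNormedModule)) with (2 := ex_series_inv_square).
  intros k. assert (Hk : 0 < INR (S k)) by (apply lt_0_INR; lia).
  change (norm ?z) with (Rabs z). rewrite Rabs_pos_eq.
  - apply Rinv_le_contravar; [now apply pow_lt|]. apply pow_incr; lra.
  - apply Rlt_le, Rinv_0_lt_compat, pow_lt. lra.
Qed.

(** Both [ln (1 + 1/n)] and [1/(n+x)] lie between [1/(n+1)] and [1/n], hence differ by at most
    [1/n^2]. *)
Lemma ex_series_ln_gamma_deriv (x : R) : 0 < x < 1 ->
  ex_series (fun k => ln (1 + / INR (S k)) - / (INR (S k) + x)).
Proof.
  intros Hx.
  apply (ex_series_le (K := R_AbsRing) (V := R_CompleteNormedModule)) with (2 := ex_series_inv_square).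
  intros k. assert (Hk : 0 < INR (S k)) by (apply lt_0_INR; lia).
  change (norm ?z) with (Rabs z). set (n := INR (S k)) in *.
  assert (0 < / n) by now apply Rinv_0_lt_compat.
  pose proof (ln_le_sub1 (1 + / n) ltac:(lra)) as H1.
  pose proof (ln_le_sub1 (/ (1 + / n)) ltac:(apply Rinv_0_lt_compat; lra)) as H2.
  rewrite ln_Rinv in H2 by lra.
  replace (/ (1 + / n) - 1) with (- / (n + 1)) in H2 by (field; lra).
  assert (/ (n + x) <= / n) by (apply Rinv_le_contravar; lra).
  assert (/ (n + 1) <= / (n + x)) by (apply Rinv_le_contravar; lra).
  assert (/ n - / (n + 1) <= / n ^ 2).
  { replace (/ n - / (n + 1)) with (/ (n * (n + 1))) by (field; lra).
    apply Rinv_le_contravar; nra. }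
  apply Rabs_le. lra.
Qed.

(** [Derive] depends on a function near the point, so [Gamma] and then [digamma] are identified on
    all of [(0, 1)] before the next derivative is taken. The passage from [Gamma (1 + z)] to
    [Gamma z] contributes the leading [/ x ^ 2]. *)
Theorem trigamma_series (x : R) : 0 < x < 1 ->
  trigamma x = / x ^ 2 + Series (fun k => / (INR (S k) + x) ^ 2).
Proof.
  intros Hx.
  set (L0 := fun y => Series (fun k => ln_gamma_term k y)).
  set (L1 := fun y => Series (fun k => ln (1 + / INR (S k)) - / (INR (S k) + y))).
  assert (Hnear : forall z, 0 < z < 1 -> exists d, 0 < d /\ forall y, Rabs (y - z) < d -> 0 < y < 1).
  { intros z Hz. exists (Rmin z (1 - z)). split; [apply Rmin_pos; lra|]. intros y Hy.
    pose proof (Rmin_l z (1 - z)). pose proof (Rmin_r z (1 - z)).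
    apply Rabs_def2 in Hy. lra. }
  assert (Hloc : forall z (P : R -> Prop), 0 < z < 1 -> (forall y, 0 < y < 1 -> P y) -> locally z P).
  { intros z P Hz HP. destruct (Hnear z Hz) as (d & Hd & Hdz).
    exists (mkposreal d Hd). intros y Hy. apply HP, Hdz, ball_Rabs, Hy. }
  assert (HL0 : forall z, 0 < z < 1 -> is_derive L0 z (L1 z)).
  { intros z Hz. destruct (Hnear z Hz) as (d & Hd & Hdz).
    apply (is_derive_Series ln_gamma_term (fun k y => ln (1 + / INR (S k)) - / (INR (S k) + y))
      (fun k => / INR (S k) ^ 2) z d Hd).
    - intros y Hy. eexists. apply is_series_ln_gamma. auto.
    - now apply ex_series_ln_gamma_deriv.
    - apply ex_series_inv_square.
    - intros k y Hy. specialize (Hdz y Hy). apply ln_gamma_term_quadratic; lra. }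
  assert (HL1 : forall z, 0 < z < 1 -> is_derive L1 z (Series (fun k => / (INR (S k) + z) ^ 2))).
  { intros z Hz. destruct (Hnear z Hz) as (d & Hd & Hdz).
    apply (is_derive_Series (fun k y => ln (1 + / INR (S k)) - / (INR (S k) + y))
      (fun k y => / (INR (S k) + y) ^ 2) (fun k => / INR (S k) ^ 2) z d Hd).
    - intros y Hy. apply ex_series_ln_gamma_deriv. auto.
    - apply ex_series_inv_square_shift. lra.
    - apply ex_series_inv_square.
    - intros k y Hy. specialize (Hdz y Hy). apply ln_gamma_deriv_term_quadratic; lra. }
  assert (HG : forall z, 0 < z < 1 -> Gamma z = exp (L0 z - ln z)).
  { intros z Hz. unfold L0. rewrite (is_series_unique _ _ (is_series_ln_gamma z Hz)).
    assert (0 < Gamma (1 + z)).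
    { replace (1 + z) with (INR 0 + 1 + z) by (simpl; ring). now apply Gamma_pos_shift. }
    rewrite <- ln_div, exp_ln by (try apply Rdiv_lt_0_compat; lra).
    rewrite Rplus_comm, Gamma_succ by lra. field. lra. }
  assert (Hdi : forall z, 0 < z < 1 -> digamma z = L1 z - / z).
  { intros z Hz. unfold digamma.
    assert (Hd : is_derive Gamma z ((L1 z - / z) * exp (L0 z - ln z))).
    { apply (is_derive_ext_loc (fun y => exp (L0 y - ln y))).
      - apply Hloc; [auto|]. intros y Hy. symmetry. now apply HG.
      - evar_last.
        + apply (is_derive_comp exp (fun y => L0 y - ln y)).
          * apply is_derive_exp.
          * apply (is_derive_minus L0 ln); [now apply HL0|apply is_derive_ln; lra].
        + reflexivity. }
    rewrite (is_derive_unique _ _ _ Hd), HG by auto. field.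
    split; [lra|apply Rgt_not_eq, exp_pos]. }
  unfold trigamma. apply is_derive_unique.
  apply (is_derive_ext_loc (fun y => L1 y - / y)).
  - apply Hloc; [auto|]. intros y Hy. symmetry. now apply Hdi.
  - evar_last.
    + apply (is_derive_minus L1 Rinv); [now apply HL1|]. apply (is_derive_Reals Rinv).
      apply is_derive_Reals. auto_derive. lra. reflexivity.
    + unfold minus, plus, opp; simpl. field. lra.
Qed.

(** * Factorization of [1 + y^m] *)

Fixpoint prod_lt (f : nat -> R) (n : nat) : R :=
  match n with
  | O => 1
  | S n' => prod_lt f n' * f n'
  end.

Lemma prod_lt_pos (f : nat -> R) (n : nat) :
  (forall k, (k < n)%nat -> 0 < f k) -> 0 < prod_lt f n.
Proof.
  induction n as [|n IH]; intros H; simpl; [lra|].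
  apply Rmult_lt_0_compat; [apply IH; intros; apply H; lia | apply H; lia].
Qed.

Lemma sum_lt_S (f : nat -> R) (n : nat) : sum_lt f (S n) = sum_lt f n + f n.
Proof. destruct n; simpl; [rewrite sum_n_0; ring | apply sum_n_S]. Qed.

Lemma ln_prod_lt (f : nat -> R) (n : nat) :
  (forall k, (k < n)%nat -> 0 < f k) -> ln (prod_lt f n) = sum_lt (fun k => ln (f k)) n.
Proof.
  induction n as [|n IH]; intros H; [apply ln_1|].
  rewrite sum_lt_S. simpl. rewrite ln_mult, IH; auto.
  apply prod_lt_pos; auto.
Qed.

(** Horner form with innermost coefficient 1. [monic_ext] admits every function with the same
    values, in place of functional extensionality. *)
Inductive monic_poly : nat -> (R -> R) -> Prop :=
| monic_one : monic_poly 0 (fun _ => 1)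
| monic_cons : forall n p c, monic_poly n p -> monic_poly (S n) (fun x => c + x * p x)
| monic_ext : forall n p q, (forall x, p x = q x) -> monic_poly n p -> monic_poly n q.

(** Synthetic division: the quotient of [c + x p] by [x - r] is [p r + x q], where [q] is the
    quotient of [p]. *)
Lemma monic_poly_factor (n : nat) (p : R -> R) (r : R) :
  monic_poly (S n) p ->
  exists q, monic_poly n q /\ forall x, p x = p r + (x - r) * q x.
Proof.
  intros H. remember (S n) as m. revert n Heqm.
  induction H as [|m p c Hp IH|m p q E Hp IH]; intros n Heq; [discriminate| |].
  - injection Heq as ->. destruct n as [|n].
    + exists p. split; [auto|]. intros x.
      assert (Hc : forall m p, monic_poly m p -> m = 0%nat -> forall x, p x = 1).
      { clear. induction 1 as [| |? ? ? E]; intros; try easy. rewrite <- E; auto. }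
      rewrite !(Hc _ _ Hp eq_refl). ring.
    + destruct (IH n eq_refl) as (q & Hq & E).
      exists (fun x => p r + x * q x). split; [now constructor|].
      intros x. rewrite (E x). ring.
  - destruct (IH n Heq) as (s & Hs & Es). exists s. split; [auto|].
    intros x. rewrite <- !E. apply Es.
Qed.

(** The last root is divided out; the cofactor vanishes at the other roots because they differ from
    it. *)
Lemma monic_poly_roots (n : nat) (p : R -> R) (r : nat -> R) :
  monic_poly n p ->
  (forall i j, (i < n)%nat -> (j < n)%nat -> r i = r j -> i = j) ->
  (forall i, (i < n)%nat -> p (r i) = 0) ->
  forall x, p x = prod_lt (fun k => x - r k) n.
Proof.
  revert p. induction n as [|n IH]; intros p Hp Hinj Hr x.
  - remember 0%nat as m. clear -Hp Heqm. subst. simpl.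
    remember 0%nat as m. revert x Heqm. induction Hp as [| |? ? ? E]; intros; try easy.
    rewrite <- E; auto.
  - destruct (monic_poly_factor n p (r n) Hp) as (q & Hq & E).
    rewrite (Hr n) in E by lia.
    simpl. rewrite E, (IH q Hq); [ring| |].
    + intros; apply Hinj; auto; lia.
    + intros i Hi. specialize (E (r i)). rewrite Hr in E by lia.
      assert (r i - r n <> 0).
      { intros H0. assert (i = n) by (apply Hinj; lia || lra). lia. }
      apply (Rmult_eq_reg_l (r i - r n)); lra.
Qed.

(* [half_cheb d] is the polynomial with
   [cos (a / 2) * half_cheb d (2 * cos a) = cos ((2 * d + 1) * a / 2)]. *)
Fixpoint half_cheb (d : nat) (X : R) : R :=
  match d with
  | O => 1
  | S O => X - 1
  | S (S d' as e) => X * half_cheb e X - half_cheb d' X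
  end.

Lemma monic_poly_minus (n k : nat) (p q : R -> R) :
  (k < n)%nat -> monic_poly n p -> monic_poly k q -> monic_poly n (fun x => p x - q x).
Proof.
  intros Hk Hp. revert k q Hk. induction Hp as [|n p c Hp IH|n p p' E Hp IH]; intros k q Hk Hq.
  - lia.
  - remember n as n0 eqn:En. revert Hk.
    induction Hq as [|k q c' Hq IHq|k q q' E Hq IHq]; intros Hk.
    + eapply monic_ext; [|apply (monic_cons _ _ (c - 1) Hp)]. intros; simpl; ring.
    + eapply monic_ext; [|apply (monic_cons _ _ (c - c') (IH k q ltac:(lia) Hq))]. intros; simpl; ring.
    + eapply monic_ext; [|apply IHq, Hk]. intros; simpl. now rewrite E.
  - eapply monic_ext; [|apply (IH k q Hk Hq)]. intros; simpl. now rewrite E.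
Qed.

Lemma half_cheb_monic (d : nat) : monic_poly d (half_cheb d) /\ monic_poly (S d) (half_cheb (S d)).
Proof.
  induction d as [|d [IH1 IH2]].
  - split; [constructor|]. eapply monic_ext; [|apply (monic_cons _ _ (-1) monic_one)].
    intros; simpl; ring.
  - split; [auto|].
    eapply monic_ext; [|apply (monic_poly_minus (S (S d)) d _ _ ltac:(lia) (monic_cons _ _ 0 IH2) IH1)].
    intros x. cbn beta. change (half_cheb (S (S d)) x) with (x * half_cheb (S d) x - half_cheb d x). ring.
Qed.

(** The recursion of [half_cheb] is [cos (b + a) + cos (b - a) = 2 cos a cos b]; as it reaches back
    two steps, two consecutive degrees are carried. *)
Lemma half_cheb_cos (d : nat) (a : R) :
  cos (a / 2) * half_cheb d (2 * cos a) = cos ((2 * INR d + 1) * (a / 2)) /\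
  cos (a / 2) * half_cheb (S d) (2 * cos a) = cos ((2 * INR (S d) + 1) * (a / 2)).
Proof.
  assert (Ha : cos a = 2 * (cos (a / 2) * cos (a / 2)) - 1).
  { replace a with (2 * (a / 2)) at 1 by field. rewrite cos_2a_cos. ring. }
  assert (Hb : sin a = 2 * sin (a / 2) * cos (a / 2)).
  { replace a with (2 * (a / 2)) at 1 by field. apply sin_2a. }
  induction d as [|d [IH1 IH2]].
  - simpl. split.
    + rewrite Rmult_1_r. f_equal. ring.
    + replace ((2 * 1 + 1) * (a / 2)) with (a + a / 2) by field. rewrite cos_plus, Ha, Hb.
      pose proof (sin2_cos2 (a / 2)) as E. unfold Rsqr in E.
      replace (2 * sin (a / 2) * cos (a / 2) * sin (a / 2))
        with (2 * cos (a / 2) * (sin (a / 2) * sin (a / 2))) by ring.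
      replace (sin (a / 2) * sin (a / 2)) with (1 - cos (a / 2) * cos (a / 2)) by lra. ring.
  - split; [auto|].
    change (half_cheb (S (S d)) (2 * cos a)) with (2 * cos a * half_cheb (S d) (2 * cos a) - half_cheb d (2 * cos a)).
    replace (cos (a / 2) * (2 * cos a * half_cheb (S d) (2 * cos a) - half_cheb d (2 * cos a)))
      with (2 * cos a * (cos (a / 2) * half_cheb (S d) (2 * cos a)) - cos (a / 2) * half_cheb d (2 * cos a)) by ring.
    rewrite IH1, IH2.
    replace ((2 * INR (S (S d)) + 1) * (a / 2)) with ((2 * INR (S d) + 1) * (a / 2) + a) by (rewrite !S_INR; field).
    replace ((2 * INR d + 1) * (a / 2)) with ((2 * INR (S d) + 1) * (a / 2) - a) by (rewrite !S_INR; field).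
    rewrite cos_plus, cos_minus. ring.
Qed.

(** The identity of [half_cheb_cos] with [y] in the role of [exp (i a)], so that [2 cos a] becomes
    [y + / y]; the recursion proves it for real [y]. *)
Lemma half_cheb_palindrome (d : nat) (y : R) : y <> 0 ->
  (1 + y) * (y ^ d * half_cheb d (y + / y)) = 1 + y ^ (2 * d + 1) /\
  (1 + y) * (y ^ S d * half_cheb (S d) (y + / y)) = 1 + y ^ (2 * S d + 1).
Proof.
  intros Hy. induction d as [|d [IH1 IH2]].
  - simpl. split; field; auto.
  - split; [auto|].
    change (half_cheb (S (S d)) (y + / y)) with ((y + / y) * half_cheb (S d) (y + / y) - half_cheb d (y + / y)).
    replace ((1 + y) * (y ^ S (S d) * ((y + / y) * half_cheb (S d) (y + / y) - half_cheb d (y + / y))))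
      with ((y ^ 2 + 1) * ((1 + y) * (y ^ S d * half_cheb (S d) (y + / y)))
            - y ^ 2 * ((1 + y) * (y ^ d * half_cheb d (y + / y)))) by (simpl; field; auto).
    rewrite IH1, IH2.
    replace (2 * S (S d) + 1)%nat with (4 + (2 * d + 1))%nat by lia.
    replace (2 * S d + 1)%nat with (2 + (2 * d + 1))%nat by lia.
    rewrite !pow_add. ring.
Qed.

Lemma phi_angle (m k : nat) : (1 <= m)%nat -> (2 * k + 1 < m)%nat ->
  0 < (2 * INR k + 1) * PI / INR m < PI.
Proof.
  intros Hm Hk. pose proof PI_RGT_0. pose proof (pos_INR k).
  assert (0 < INR m) by (apply lt_0_INR; lia).
  assert (2 * INR k + 1 < INR m).
  { apply lt_INR in Hk. rewrite plus_INR, mult_INR in Hk. exact Hk. }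
  split.
  - apply Rdiv_lt_0_compat; nra.
  - apply (Rmult_lt_reg_r (INR m)); [auto|]. unfold Rdiv. rewrite Rmult_assoc, Rinv_l by lra. nra.
Qed.

Lemma prod_lt_palindrome (y : R) (r : nat -> R) (n : nat) : y <> 0 ->
  y ^ n * prod_lt (fun k => y + / y - r k) n = prod_lt (fun k => y ^ 2 - r k * y + 1) n.
Proof.
  intros Hy. induction n as [|n IH]; cbn [prod_lt]; [simpl; ring|].
  rewrite <- IH, <- tech_pow_Rmult. field. auto.
Qed.

(** The numbers [2 phi_k] are the roots of [half_cheb d]: at the angle [a] of [phi_k],
    [(2d+1) a / 2] is [k PI + PI / 2] while [cos (a / 2)] is not 0. They are distinct because the
    angles lie in [(0, PI)], where the cosine is injective. *)
Theorem one_plus_pow_factor (d : nat) (y : R) : y <> 0 ->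
  1 + y ^ (2 * d + 1) =
  (1 + y) * prod_lt (fun k => y ^ 2 - 2 * phi (2 * d + 1) k * y + 1) d.
Proof.
  intros Hy. rewrite <- (proj1 (half_cheb_palindrome d y Hy)). f_equal.
  pose proof PI_RGT_0 as Hpi.
  rewrite (monic_poly_roots d (half_cheb d) (fun k => 2 * phi (2 * d + 1) k)).
  - now apply prod_lt_palindrome with (r := fun k => 2 * phi (2 * d + 1) k).
  - apply half_cheb_monic.
  - intros i j Hi Hj E. unfold phi in E.
    pose proof (phi_angle (2 * d + 1) i ltac:(lia) ltac:(lia)).
    pose proof (phi_angle (2 * d + 1) j ltac:(lia) ltac:(lia)).
    assert (E' : (2 * INR i + 1) * PI / INR (2 * d + 1) = (2 * INR j + 1) * PI / INR (2 * d + 1)).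
    { apply cos_inj; lra. }
    assert (0 < INR (2 * d + 1)) by (apply lt_0_INR; lia).
    apply INR_eq.
    apply (f_equal (fun z => z * (INR (2 * d + 1) / PI))) in E'.
    field_simplify in E'; lra.
  - intros i Hi. pose proof (phi_angle (2 * d + 1) i ltac:(lia) ltac:(lia)) as Ha.
    unfold phi. set (a := (2 * INR i + 1) * PI / INR (2 * d + 1)) in *.
    apply (Rmult_eq_reg_l (cos (a / 2))).
    2:{ apply Rgt_not_eq, cos_gt_0; lra. }
    rewrite (proj1 (half_cheb_cos d a)), Rmult_0_r.
    assert (0 < INR (2 * d + 1)) by (apply lt_0_INR; lia).
    replace ((2 * INR d + 1) * (a / 2)) with (INR i * PI + PI / 2).
    + apply cos_eq_0_1. exists (Z.of_nat i). now rewrite <- INR_IZR_INZ.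
    + unfold a. replace (2 * INR d + 1) with (INR (2 * d + 1)) by (rewrite plus_INR, mult_INR; reflexivity).
      field. lra.
Qed.

(** * Logarithmic integrals of trinomials *)

Lemma continuity_2d_pt_pos (w : R -> R -> R) (x y : R) :
  continuity_2d_pt w x y -> 0 < w x y -> locally_2d (fun u v => 0 < w u v) x y.
Proof.
  intros Hc Hp. destruct (Hc (mkposreal _ Hp)) as [d Hd].
  exists d. intros u v Hu Hv. specialize (Hd u v Hu Hv). cbn [pos] in Hd.
  apply Rabs_def2 in Hd. lra.
Qed.

(** Differentiation under the integral sign in a form that serves both deformations, by the angle
    and by the radius. *)
Lemma is_derive_RInt_ln (w dw : R -> R -> R) (g : R -> R) (a : R) :
  (forall u v, is_derive (fun z => w z v) u (dw u v)) ->
  (forall u v, continuous (w u) v) ->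
  (forall t, 0 <= t <= 1 -> continuous g t) ->
  (forall t, 0 <= t <= 1 -> continuity_2d_pt w a t) ->
  (forall t, 0 <= t <= 1 -> continuity_2d_pt dw a t) ->
  locally a (fun u => forall t, 0 <= t <= 1 -> 0 < w u t) ->
  is_derive (fun u => RInt (fun x => ln (w u x) * g x) 0 1) a
    (RInt (fun x => dw a x / w a x * g x) 0 1).
Proof.
  intros Hd Hcx Hg Hw Hdw Hpos.
  assert (HD : forall u v, 0 < w u v -> is_derive (fun z => ln (w z v) * g v) u (dw u v / w u v * g v)).
  { intros u v H. specialize (Hd u v). evar_last.
    - apply (is_derive_mult (fun z => ln (w z v)) (fun _ => g v)).
      + apply (is_derive_comp ln); [apply is_derive_ln, H|apply Hd].
      + apply is_derive_const.
      + intros; apply Rmult_comm.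
    - unfold plus, mult, zero, scal; simpl; unfold mult; simpl. field. lra. }
  rewrite (RInt_ext _ (fun x => Derive (fun u => ln (w u x) * g x) a)).
  2:{ intros x Hx. rewrite Rmin_left, Rmax_right in Hx by lra. symmetry.
      apply is_derive_unique, HD. apply (locally_singleton a _ Hpos). lra. }
  apply (is_derive_RInt_param (fun u x => ln (w u x) * g x)).
  - apply filter_imp with (2 := Hpos). intros u H t Ht.
    rewrite Rmin_left, Rmax_right in Ht by lra. eexists. apply HD; auto.
  - intros t Ht. rewrite Rmin_left, Rmax_right in Ht by lra.
    assert (H0 : 0 < w a t) by (apply (locally_singleton a _ Hpos); auto).
    apply (continuity_2d_pt_ext_loc (fun u v => dw u v * / w u v * g v)).
    + destruct (continuity_2d_pt_pos w a t (Hw t Ht) H0) as [d H].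
      exists d. intros u v Hu Hv. symmetry. apply is_derive_unique, HD. auto.
    + apply continuity_2d_pt_mult.
      * apply continuity_2d_pt_mult; [auto|]. apply continuity_2d_pt_inv; [auto|lra].
      * apply (continuity_1d_2d_pt_comp g (fun _ v => v)).
        -- apply continuity_pt_filterlim. now apply Hg.
        -- apply continuity_2d_pt_id2.
  - apply filter_imp with (2 := Hpos). intros u H. apply ex_RInt_continuous_le; [lra|].
    intros x Hx. apply (continuous_mult (fun x => ln (w u x)) g); [|auto].
    apply continuous_comp; [auto|].
    apply (ex_derive_continuous ln). eexists. apply is_derive_ln; auto.
Qed.

Definition cyclo6 (x : R) : R := x ^ 2 - x + 1.

Lemma cyclo6_lower (x : R) : 3 / 4 <= cyclo6 x.
Proof. unfold cyclo6. pose proof (pow2_ge_0 (x - 1 / 2)). nra. Qed.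

Lemma cyclo6_inv_bounds (x : R) : 0 < / cyclo6 x <= 4 / 3.
Proof.
  pose proof (cyclo6_lower x). split; [apply Rinv_0_lt_compat; lra|].
  replace (4 / 3) with (/ (3 / 4)) by field. apply Rinv_le_contravar; lra.
Qed.

Lemma continuous_inv_cyclo6 (x : R) : continuous (fun x => / cyclo6 x) x.
Proof.
  pose proof (cyclo6_lower x) as H.
  apply (ex_derive_continuous (fun x => / cyclo6 x)). unfold cyclo6 in *. auto_derive. lra.
Qed.

Definition quad (a x : R) : R := x ^ 2 + 2 * x * cos a + 1.

Lemma quad_pos (a x : R) : 0 <= x -> - 1 < cos a -> 0 < quad a x.
Proof.
  intros Hx Ha. unfold quad. pose proof (pow2_ge_0 (x - 1)).
  destruct (Req_dec x 0) as [->|]; [lra|]. nra.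
Qed.

(** The arguments of the arctangent at 1 and 0 are [cot (a / 2)] and [cot a], so its values differ
    by [a / 2]. *)
Lemma is_RInt_inv_quad (a : R) : 0 < a < PI ->
  is_RInt (fun x => / quad a x) 0 1 (a / (2 * sin a)).
Proof.
  intros Ha. assert (Hs : 0 < sin a) by (apply sin_gt_0; lra).
  assert (Hc : -1 < cos a) by (rewrite <- cos_PI; apply cos_decreasing_1; lra).
  set (F := fun x => / sin a * atan ((x + cos a) / sin a)).
  replace (a / (2 * sin a)) with (F 1 - F 0).
  - pose proof (sin2_cos2 a) as E. unfold Rsqr in E.
    apply is_RInt_derive_le; [lra| |]; intros x Hx; pose proof (quad_pos a x ltac:(lra) Hc) as Hq; unfold F, quad in *.
    + auto_derive. lra.
      replace (1 + (x + cos a) * / sin a * ((x + cos a) * / sin a * 1)) with ((x ^ 2 + 2 * x * cos a + 1) / (sin a * sin a)).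
      * field. lra.
      * transitivity ((x ^ 2 + 2 * x * cos a + (sin a * sin a + cos a * cos a)) / (sin a * sin a)); [now rewrite E|field; lra].
    + apply (ex_derive_continuous (fun x => / (x ^ 2 + 2 * x * cos a + 1))). auto_derive. lra.
  - assert (Hs2 : 0 < sin (a / 2)) by (apply sin_gt_0; lra).
    assert (Hsa : sin a = 2 * sin (a / 2) * cos (a / 2)) by (rewrite <- sin_2a; f_equal; field).
    assert (Hca : 1 + cos a = 2 * (cos (a / 2) * cos (a / 2))).
    { replace (cos a) with (cos (2 * (a / 2))) by (f_equal; field). rewrite cos_2a_cos. ring. }
    assert (0 < cos (a / 2)) by (apply cos_gt_0; lra).
    unfold F. replace ((1 + cos a) / sin a) with (tan (PI / 2 - a / 2)).
    2:{ unfold tan. rewrite sin_shift, cos_shift, Hca, Hsa. field. lra. }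
    replace ((0 + cos a) / sin a) with (tan (PI / 2 - a)).
    2:{ unfold tan. rewrite sin_shift, cos_shift. field. lra. }
    rewrite !atan_tan by lra. field. lra.
Qed.

Lemma sqrt3_sq : sqrt 3 * sqrt 3 = 3.
Proof. apply sqrt_sqrt; lra. Qed.

Lemma sqrt3_pos : 0 < sqrt 3.
Proof. apply sqrt_lt_R0; lra. Qed.

Lemma cos_2PI3 : cos (2 * PI / 3) = - (1 / 2).
Proof. replace (2 * PI / 3) with (PI - PI / 3) by field. rewrite Rtrigo_facts.cos_pi_minus, cos_PI3. field. Qed.

Lemma sin_2PI3 : sin (2 * PI / 3) = sqrt 3 / 2.
Proof. replace (2 * PI / 3) with (PI - PI / 3) by field. rewrite Rtrigo_facts.sin_pi_minus, sin_PI3. field. Qed.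

(** The integral of [/ cyclo6] over [[0, 1]], from the trinomial of angle [2 PI / 3]; every
    [PI sqrt 3] of the theorem is a multiple of it. *)
Definition c1 : R := 2 * PI * sqrt 3 / 9.

Lemma is_RInt_inv_cyclo6 : is_RInt (fun x => / cyclo6 x) 0 1 c1.
Proof.
  pose proof PI_RGT_0. pose proof sqrt3_sq. pose proof sqrt3_pos.
  replace c1 with (2 * PI / 3 / (2 * sin (2 * PI / 3))).
  - apply is_RInt_ext with (2 := is_RInt_inv_quad (2 * PI / 3) ltac:(lra)).
    intros x _. unfold quad, cyclo6. rewrite cos_2PI3. f_equal. field.
  - rewrite sin_2PI3. unfold c1.
    apply (Rmult_eq_reg_r (sqrt 3)); [|lra].
    replace (2 * PI * sqrt 3 / 9 * sqrt 3) with (2 * PI * (sqrt 3 * sqrt 3) / 9) by field.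
    rewrite sqrt3_sq. field. lra.
Qed.

Definition quad_integral (a : R) : R := RInt (fun x => ln (quad a x) * / cyclo6 x) 0 1.

Lemma locally_cos_gt (a : R) : -1 < cos a -> locally a (fun u => -1 < cos u).
Proof.
  intros Ha.
  assert (Hc : continuous cos a) by (apply (ex_derive_continuous cos); auto_derive; auto).
  apply (Hc (fun y => -1 < y)). exists (mkposreal (cos a + 1) ltac:(lra)).
  intros y Hy. apply ball_Rabs in Hy; cbn [pos] in Hy. apply Rabs_def2 in Hy. lra.
Qed.

Lemma is_derive_quad_integral_param (a : R) : -1 < cos a ->
  is_derive quad_integral a (RInt (fun x => (- 2 * x * sin a) / quad a x * / cyclo6 x) 0 1).
Proof.
  intros Ha.
  apply (is_derive_RInt_ln quad (fun a x => - 2 * x * sin a) (fun x => / cyclo6 x)).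
  - intros u v. unfold quad. auto_derive. auto. ring.
  - intros u v. apply (ex_derive_continuous (quad u)). unfold quad. auto_derive. auto.
  - intros t _. apply continuous_inv_cyclo6.
  - intros t _. unfold quad.
    repeat first [apply continuity_2d_pt_plus | apply continuity_2d_pt_mult | apply continuity_2d_pt_const
      | apply continuity_2d_pt_id2 ].
    + apply (continuity_1d_2d_pt_comp cos (fun u _ => u)); [apply continuity_cos|apply continuity_2d_pt_id1].
  - intros t _.
    repeat first [apply continuity_2d_pt_plus | apply continuity_2d_pt_mult | apply continuity_2d_pt_const
      | apply continuity_2d_pt_id2 ].
    apply (continuity_1d_2d_pt_comp sin (fun u _ => u)); [apply continuity_sin|apply continuity_2d_pt_id1].
  - apply filter_imp with (2 := locally_cos_gt a Ha). intros u Hu t Ht. apply quad_pos; lra.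
Qed.

(** Since [quad a x - cyclo6 x = (1 + 2 cos a) x], the factor [x] of the integrand splits it into a
    multiple of [1 / cyclo6 - 1 / quad]. At [cos a = - 1 / 2] the two trinomials coincide. *)
Lemma is_derive_quad_integral (a : R) : 0 < a < PI -> cos a <> - (1 / 2) ->
  is_derive quad_integral a ((a - 2 * c1 * sin a) / (1 + 2 * cos a)).
Proof.
  intros Ha Hc.
  assert (Hc1 : -1 < cos a) by (rewrite <- cos_PI; apply cos_decreasing_1; lra).
  assert (Hs : 0 < sin a) by (apply sin_gt_0; lra).
  evar_last; [apply (is_derive_quad_integral_param a Hc1)|].
  apply is_RInt_unique.
  replace ((a - 2 * c1 * sin a) / (1 + 2 * cos a)) with (scal (- (sin a / (cos a + 1 / 2))) (minus c1 (a / (2 * sin a)))).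
  - apply (is_RInt_ext (fun x => scal (- (sin a / (cos a + 1 / 2))) (minus (/ cyclo6 x) (/ quad a x)))).
    + intros x Hx. rewrite Rmin_left, Rmax_right in Hx by lra.
      pose proof (quad_pos a x ltac:(lra) Hc1) as Hq. pose proof (cyclo6_lower x) as HQ.
      unfold scal, minus, plus, opp; simpl; unfold mult; simpl.
      unfold quad, cyclo6 in *. field. repeat split; lra.
    + apply (is_RInt_scal (V := R_NormedModule)), (is_RInt_minus (V := R_NormedModule)).
      apply is_RInt_inv_cyclo6. now apply is_RInt_inv_quad.
  - unfold scal, minus, plus, opp; simpl; unfold mult; simpl. field. lra.
Qed.

(** * The combination over three angles *)

Lemma cos_2PI3_plus (t : R) : cos (2 * PI / 3 + t) = - (1 / 2) * cos t - sqrt 3 / 2 * sin t.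
Proof. rewrite cos_plus, cos_2PI3, sin_2PI3. ring. Qed.

Lemma sin_2PI3_plus (t : R) : sin (2 * PI / 3 + t) = sqrt 3 / 2 * cos t - 1 / 2 * sin t.
Proof. rewrite sin_plus, cos_2PI3, sin_2PI3. ring. Qed.

Lemma cos_2PI3_minus (t : R) : cos (2 * PI / 3 - t) = - (1 / 2) * cos t + sqrt 3 / 2 * sin t.
Proof. rewrite cos_minus, cos_2PI3, sin_2PI3. ring. Qed.

Lemma sin_2PI3_minus (t : R) : sin (2 * PI / 3 - t) = sqrt 3 / 2 * cos t + 1 / 2 * sin t.
Proof. rewrite sin_minus, cos_2PI3, sin_2PI3. ring. Qed.

(** Endpoints are reached by continuity, because the closed forms of the derivatives break down
    there: two of the three angles are [2 PI / 3] at [t = 0], and [1 - u^3] vanishes at [u = 1]. *)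
Lemma constant_of_derive_0 (f : R -> R) (a b : R) : a <= b ->
  (forall x, a < x < b -> is_derive f x 0) ->
  (forall x, a <= x <= b -> continuity_pt f x) -> f a = f b.
Proof.
  intros Hab Hd Hc. destruct (MVT_gen f a b (fun _ => 0)) as (c & _ & E).
  - intros x Hx. rewrite Rmin_left, Rmax_right in Hx by lra. auto.
  - intros x Hx. rewrite Rmin_left, Rmax_right in Hx by lra. auto.
  - lra.
Qed.

Definition triple_integral (t : R) : R :=
  quad_integral t + quad_integral (2 * PI / 3 + t) + quad_integral (2 * PI / 3 - t).

Lemma cos_gt_half (t : R) : 0 <= t < PI / 3 -> 1 / 2 < cos t.
Proof. intros Ht. pose proof PI_RGT_0. rewrite <- cos_PI3. apply cos_decreasing_1; lra. Qed.

Lemma triple_cos_bounds (t : R) : 0 <= t < PI / 3 ->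
  -1 < cos t /\ -1 < cos (2 * PI / 3 + t) /\ -1 < cos (2 * PI / 3 - t).
Proof.
  intros Ht. pose proof PI_RGT_0.
  repeat split; rewrite <- cos_PI; apply cos_decreasing_1; lra.
Qed.

Lemma is_derive_reparam (f : R -> R) (s a t l : R) :
  is_derive f (a + s * t) l -> is_derive (fun x => f (a + s * x)) t (s * l).
Proof.
  intros H. evar_last.
  - apply (is_derive_comp f (fun x => a + s * x)); [apply H|].
    assert (Hl : is_derive (fun x => a + s * x) t s) by (auto_derive; auto; ring). apply Hl.
  - reflexivity.
Qed.

Lemma is_derive_triple (t l0 l1 l2 : R) :
  is_derive quad_integral t l0 -> is_derive quad_integral (2 * PI / 3 + t) l1 ->
  is_derive quad_integral (2 * PI / 3 - t) l2 ->
  is_derive triple_integral t (l0 + l1 - l2).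
Proof.
  intros H0 H1 H2. replace (l0 + l1 - l2) with (l0 + 1 * l1 + (-1) * l2) by ring.
  apply (is_derive_ext (fun t => quad_integral t + quad_integral (2 * PI / 3 + 1 * t) + quad_integral (2 * PI / 3 + (-1) * t))).
  { intros x. unfold triple_integral. f_equal; [f_equal|]; f_equal; ring. }
  apply (is_derive_plus (fun t => quad_integral t + quad_integral (2 * PI / 3 + 1 * t))).
  - apply (is_derive_plus quad_integral); [auto|]. apply is_derive_reparam.
    now rewrite Rmult_1_l.
  - apply is_derive_reparam. replace (2 * PI / 3 + -1 * t) with (2 * PI / 3 - t) by ring. auto.
Qed.

(** [c], [s], [r], [p] stand for [cos t], [sin t], [sqrt 3], [PI]. The coefficient of [t] is the sum
    of the inverses of the three denominators, which is 0 by the first two hypotheses. *)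
Lemma triple_derivative_value (t c s r p : R) :
  s * s + c * c = 1 -> r * r = 3 -> 1 + 2 * c <> 0 -> 1 - c - r * s <> 0 -> 1 - c + r * s <> 0 ->
  (t - 2 * (2 * p * r / 9) * s) / (1 + 2 * c)
  + (2 * p / 3 + t - 2 * (2 * p * r / 9) * (r / 2 * c - 1 / 2 * s)) / (1 - c - r * s)
  - (2 * p / 3 - t - 2 * (2 * p * r / 9) * (r / 2 * c + 1 / 2 * s)) / (1 - c + r * s)
  = - (3 * (2 * p * r / 9) * (2 * s) / (1 + 2 * c)).
Proof.
  intros H1 H2 Ha Hb Hc.
  (* Inverses become variables tied by [z * / z = 1], which makes the claim polynomial, as [nsatz]
     requires. *)
  assert (Hi : (1 + 2 * c) * / (1 + 2 * c) = 1) by now apply Rinv_r.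
  assert (Hj : (1 - c - r * s) * / (1 - c - r * s) = 1) by now apply Rinv_r.
  assert (Hk : (1 - c + r * s) * / (1 - c + r * s) = 1) by now apply Rinv_r.
  unfold Rdiv.
  assert (H9 : 9 * / 9 = 1) by (field). assert (H3 : 3 * / 3 = 1) by field. assert (H22 : 2 * / 2 = 1) by field.
  revert Hi Hj Hk H9 H3 H22.
  generalize (/ (1 + 2 * c)) (/ (1 - c - r * s)) (/ (1 - c + r * s)) (/ 9) (/ 3) (/ 2).
  intros i j k n th h Hi Hj Hk H9 H3 H22. nsatz.
Qed.

(** The bound [PI / 3] keeps [2 PI / 3 + t] below [PI], so that all three trinomials stay positive
    on [[0, 1]]. *)
Lemma triple_integral_value (t : R) : 0 <= t < PI / 3 ->
  triple_integral t = triple_integral 0 + 3 * c1 * (ln (1 + 2 * cos t) - ln 3).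
Proof.
  intros Ht. pose proof PI_RGT_0. pose proof sqrt3_pos. pose proof sqrt3_sq.
  enough (E : triple_integral 0 - 3 * c1 * ln (1 + 2 * cos 0) = triple_integral t - 3 * c1 * ln (1 + 2 * cos t)).
  { rewrite cos_0 in E. replace (1 + 2 * 1) with 3 in E by ring. lra. }
  assert (Hln : forall x, 0 <= x < PI / 3 -> is_derive (fun t => 3 * c1 * ln (1 + 2 * cos t)) x (- (3 * c1 * (2 * sin x) / (1 + 2 * cos x)))).
  { intros x Hx. pose proof (cos_gt_half x Hx). auto_derive. lra. field. lra. }
  apply (constant_of_derive_0 (fun t => triple_integral t - 3 * c1 * ln (1 + 2 * cos t))); [lra| |].
  - intros x Hx. pose proof (cos_gt_half x ltac:(lra)) as Hc.
    assert (Hs : 0 < sin x) by (apply sin_gt_0; lra).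
    pose proof (sin2_cos2 x) as E. unfold Rsqr in E.
    assert (Hp : - (1 / 2) > cos (2 * PI / 3 + x)) by (rewrite <- cos_2PI3; apply cos_decreasing_1; lra).
    assert (Hm : - (1 / 2) < cos (2 * PI / 3 - x)) by (rewrite <- cos_2PI3; apply cos_decreasing_1; lra).
    evar_last.
    + apply (is_derive_minus triple_integral).
      * apply is_derive_triple; apply is_derive_quad_integral; lra.
      * apply Hln; lra.
    + rewrite cos_2PI3_plus in *. rewrite cos_2PI3_minus in *. rewrite sin_2PI3_plus, sin_2PI3_minus.
      unfold minus, plus, opp; simpl.
      replace (1 + 2 * (- (1 / 2) * cos x - sqrt 3 / 2 * sin x)) with (1 - cos x - sqrt 3 * sin x) by field.
      replace (1 + 2 * (- (1 / 2) * cos x + sqrt 3 / 2 * sin x)) with (1 - cos x + sqrt 3 * sin x) by field.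
      unfold c1. rewrite triple_derivative_value; try lra.
  - intros x Hx. apply continuity_pt_filterlim.
    apply (ex_derive_continuous (fun t => triple_integral t - 3 * c1 * ln (1 + 2 * cos t))).
    destruct (triple_cos_bounds x ltac:(lra)) as (B0 & B1 & B2).
    eexists. apply (is_derive_minus triple_integral).
    + apply is_derive_triple; apply is_derive_quad_integral_param; auto.
    + apply Hln; lra.
Qed.

(** [quad a x] is [(x + exp (i a)) (x + exp (- i a))]. Up to sign and multiples of [2 PI] the three
    angles have the same triple, so the factors group into [(x^3 + exp (3 i t)) (x^3 + exp (- 3 i
    t))]. *)
Lemma quad_triple_product (t x : R) :
  quad t x * quad (2 * PI / 3 + t) x * quad (2 * PI / 3 - t) x =
  x ^ 6 + 2 * cos (3 * t) * x ^ 3 + 1.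
Proof.
  unfold quad. rewrite cos_2PI3_plus, cos_2PI3_minus.
  replace (cos (3 * t)) with (4 * cos t * cos t * cos t - 3 * cos t).
  - pose proof sqrt3_sq as H. pose proof (sin2_cos2 t) as E. unfold Rsqr in E.
    assert (H22 : 2 * / 2 = 1) by field. unfold Rdiv.
    replace (x ^ 6) with (x * x * x * (x * x * x)) by ring.
    replace (x ^ 3) with (x * x * x) by ring. replace (x ^ 2) with (x * x) by ring.
    generalize dependent (/ 2). generalize dependent (sqrt 3).
    generalize dependent (cos t). generalize dependent (sin t). intros s c E r Er h Eh.
    nsatz.
  - replace (3 * t) with (2 * t + t) by ring. rewrite cos_plus, cos_2a_cos, sin_2a.
    pose proof (sin2_cos2 t) as E. unfold Rsqr in E.
    generalize dependent (cos t). generalize dependent (sin t). intros s c E. nsatz.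
Qed.

Lemma ex_RInt_ln_quad (a : R) : -1 < cos a -> ex_RInt (fun x => ln (quad a x) * / cyclo6 x) 0 1.
Proof.
  intros Ha. apply ex_RInt_continuous_le; [lra|]. intros x Hx.
  apply (continuous_mult (fun x => ln (quad a x))); [|apply continuous_inv_cyclo6].
  pose proof (quad_pos a x ltac:(lra) Ha).
  apply (ex_derive_continuous (fun x => ln (quad a x))). unfold quad in *. auto_derive. lra.
Qed.

Lemma is_RInt_triple (t : R) : 0 <= t < PI / 3 ->
  is_RInt (fun x => ln (x ^ 6 + 2 * cos (3 * t) * x ^ 3 + 1) * / cyclo6 x) 0 1 (triple_integral t).
Proof.
  intros Ht. destruct (triple_cos_bounds t Ht) as (B0 & B1 & B2).
  apply (is_RInt_ext (fun x => plus (plus (ln (quad t x) * / cyclo6 x) (ln (quad (2 * PI / 3 + t) x) * / cyclo6 x))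
    (ln (quad (2 * PI / 3 - t) x) * / cyclo6 x))).
  - intros x Hx. rewrite Rmin_left, Rmax_right in Hx by lra.
    rewrite <- quad_triple_product.
    pose proof (quad_pos t x ltac:(lra) B0).
    pose proof (quad_pos _ x ltac:(lra) B1).
    pose proof (quad_pos _ x ltac:(lra) B2).
    rewrite !ln_mult by (repeat apply Rmult_lt_0_compat; auto).
    unfold plus; simpl. ring.
  - apply (is_RInt_plus (V := R_NormedModule)); [apply (is_RInt_plus (V := R_NormedModule))|];
      apply RInt_correct_R, ex_RInt_ln_quad; auto.
Qed.

(** * The radial integral *)

Lemma is_derive_primitive (f : R -> R) (u : R) :
  (forall x, -1 < x -> continuous f x) -> -1 < u -> is_derive (fun u => RInt f 0 u) u (f u).
Proof.
  intros Hc Hu. apply (is_derive_RInt f (fun u => RInt f 0 u) 0).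
  - exists (mkposreal (u + 1) ltac:(lra)). intros b Hb. apply ball_Rabs in Hb; cbn [pos] in Hb.
    apply Rabs_def2 in Hb. apply RInt_correct_R.
    apply (ex_RInt_continuous (V := R_CompleteNormedModule)). intros z Hz. apply Hc.
    destruct Hz as [Hz _]. eapply Rlt_le_trans; [|apply Hz].
    apply Rmin_glb_lt; lra.
  - now apply Hc.
Qed.

Lemma one_plus_cube_pos (x : R) : -1 < x -> 0 < 1 + x ^ 3.
Proof.
  intros Hx. replace (1 + x ^ 3) with ((1 + x) * cyclo6 x) by (unfold cyclo6; ring).
  pose proof (cyclo6_lower x). apply Rmult_lt_0_compat; lra.
Qed.

(** [prim0] and [prim1] enter only through their sum at 1 and through inversion of the argument; no
    closed form is computed. *)
Definition prim0 (u : R) : R := RInt (fun s => / (1 + s ^ 3)) 0 u.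
Definition prim1 (u : R) : R := RInt (fun s => s / (1 + s ^ 3)) 0 u.

Lemma continuous_inv_cube (x : R) : -1 < x -> continuous (fun s => / (1 + s ^ 3)) x.
Proof.
  intros Hx. pose proof (one_plus_cube_pos x Hx).
  apply (ex_derive_continuous (fun s => / (1 + s ^ 3))). auto_derive. simpl in *; lra.
Qed.

Lemma continuous_id_inv_cube (x : R) : -1 < x -> continuous (fun s => s / (1 + s ^ 3)) x.
Proof.
  intros Hx. apply (continuous_mult (fun s => s) (fun s => / (1 + s ^ 3))).
  - apply continuous_id.
  - now apply continuous_inv_cube.
Qed.

Lemma is_derive_prim0 (u : R) : -1 < u -> is_derive prim0 u (/ (1 + u ^ 3)).
Proof. apply (is_derive_primitive (fun s => / (1 + s ^ 3))). apply continuous_inv_cube. Qed.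

Lemma is_derive_prim1 (u : R) : -1 < u -> is_derive prim1 u (u / (1 + u ^ 3)).
Proof. apply (is_derive_primitive (fun s => s / (1 + s ^ 3))). apply continuous_id_inv_cube. Qed.

Lemma prim_sum : prim0 1 + prim1 1 = c1.
Proof.
  assert (H : is_RInt (fun x => plus (/ (1 + x ^ 3)) (x / (1 + x ^ 3))) 0 1 (prim0 1 + prim1 1)).
  { apply (is_RInt_plus (V := R_NormedModule)); apply RInt_correct_R, ex_RInt_continuous_le; try lra; intros.
    - apply continuous_inv_cube; lra.
    - apply continuous_id_inv_cube; lra. }
  rewrite <- (is_RInt_unique _ _ _ _ H), <- (is_RInt_unique _ _ _ _ is_RInt_inv_cyclo6).
  apply RInt_ext. intros x Hx. rewrite Rmin_left, Rmax_right in Hx by lra.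
  pose proof (one_plus_cube_pos x ltac:(lra)). pose proof (cyclo6_lower x).
  unfold plus, cyclo6 in *; simpl (AbelianMonoid.plus _ _).
  change (/ (1 + x ^ 3) + x / (1 + x ^ 3) = / (x ^ 2 - x + 1)). field. lra.
Qed.

Lemma is_derive_scale_arg (f : R -> R) (a x l : R) :
  is_derive f (a * x) l -> is_derive (fun y => f (a * y)) x (a * l).
Proof.
  intros H. apply (is_derive_ext (fun y => f (0 + a * y))).
  - intros; now rewrite Rplus_0_l.
  - apply is_derive_reparam. now rewrite Rplus_0_l.
Qed.

Lemma is_derive_inv_arg (f : R -> R) (u l : R) : 0 < u ->
  is_derive f (/ u) l -> is_derive (fun y => f (/ y)) u (- / u ^ 2 * l).
Proof.
  intros Hu H. evar_last.
  - apply (is_derive_comp f Rinv); [apply H|].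
    assert (Hi : is_derive Rinv u (- / u ^ 2)) by (auto_derive; [lra|field; lra]). apply Hi.
  - reflexivity.
Qed.

(* The substitution [s -> 1/s] exchanges the two primitives. *)
Lemma prim_inv (u : R) : 0 < u <= 1 ->
  prim0 (/ u) + prim1 u = c1 /\ prim1 (/ u) + prim0 u = c1.
Proof.
  intros Hu.
  assert (Hd : forall x, 0 < x -> -1 < / x /\ -1 < x).
  { intros x Hx. assert (0 < / x) by now apply Rinv_0_lt_compat. lra. }
  assert (H0 : forall x, 0 < x -> is_derive (fun u => prim0 (/ u) + prim1 u) x 0).
  { intros x Hx. destruct (Hd x Hx). pose proof (one_plus_cube_pos x ltac:(auto)). evar_last.
    - apply (is_derive_plus (fun u => prim0 (/ u)) prim1).
      + apply is_derive_inv_arg; [auto|]. apply is_derive_prim0; auto.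
      + apply is_derive_prim1; auto.
    - unfold plus; simpl. field. assert (x ^ 3 + 1 <> 0) by lra. simpl in *. repeat split; lra. }
  assert (H1 : forall x, 0 < x -> is_derive (fun u => prim1 (/ u) + prim0 u) x 0).
  { intros x Hx. destruct (Hd x Hx). pose proof (one_plus_cube_pos x ltac:(auto)). evar_last.
    - apply (is_derive_plus (fun u => prim1 (/ u)) prim0).
      + apply is_derive_inv_arg; [auto|]. apply is_derive_prim1; auto.
      + apply is_derive_prim0; auto.
    - unfold plus; simpl. field. assert (x ^ 3 + 1 <> 0) by lra. simpl in *. repeat split; lra. }
  split; rewrite <- prim_sum.
  - transitivity (prim0 (/ 1) + prim1 1); [|now rewrite Rinv_1].
    apply (constant_of_derive_0 (fun u => prim0 (/ u) + prim1 u)); [lra| |]; intros x Hx.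
    + apply H0; lra.
    + apply continuity_pt_filterlim, (ex_derive_continuous (fun u => prim0 (/ u) + prim1 u)).
      eexists. apply H0; lra.
  - transitivity (prim1 (/ 1) + prim0 1); [|rewrite Rinv_1; ring].
    apply (constant_of_derive_0 (fun u => prim1 (/ u) + prim0 u)); [lra| |]; intros x Hx.
    + apply H1; lra.
    + apply continuity_pt_filterlim, (ex_derive_continuous (fun u => prim1 (/ u) + prim0 u)).
      eexists. apply H1; lra.
Qed.

(** At [u = 1] this is [(1 + x^3)^2], the triple product with [t = 0]; at [u = 0] it is [x^3]. *)
Definition radial (u x : R) : R := (1 + u ^ 3 * x ^ 3) * (x ^ 3 + u ^ 3).

Lemma radial_factors_pos (u x : R) : 0 < u -> 0 <= x -> 0 < 1 + u ^ 3 * x ^ 3 /\ 0 < x ^ 3 + u ^ 3.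
Proof.
  intros Hu Hx. assert (0 < u ^ 3) by now apply pow_lt. assert (0 <= x ^ 3) by now apply pow_le.
  split; nra.
Qed.

(** The substitutions [s = u x] and [s = x / u] produce the two primitives at [u] and at [/ u],
    which [prim_inv] pairs into multiples of [c1]. *)
Lemma is_RInt_radial_kernel (u : R) : 0 < u <= 1 ->
  is_RInt (fun x => (1 + x) * (/ (1 + u ^ 3 * x ^ 3) + / (x ^ 3 + u ^ 3))) 0 1 (c1 * (/ u + / u ^ 2)).
Proof.
  intros Hu. assert (Hi : 0 < / u) by (apply Rinv_0_lt_compat; lra).
  set (F := fun x => / u * prim0 (u * x) + / u ^ 2 * prim1 (u * x)
    + (/ u ^ 2 * prim0 (/ u * x) + / u * prim1 (/ u * x))).
  replace (c1 * (/ u + / u ^ 2)) with (F 1 - F 0).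
  - apply is_RInt_derive_le; [lra| |]; intros x Hx;
      destruct (radial_factors_pos u x ltac:(lra) ltac:(lra)) as [P1 P2].
    + assert (0 <= u * x) by nra. assert (0 <= / u * x) by nra.
      pose proof (one_plus_cube_pos (u * x) ltac:(lra)) as P3.
      pose proof (one_plus_cube_pos (/ u * x) ltac:(lra)) as P4.
      evar_last.
      * apply (is_derive_plus (fun x => / u * prim0 (u * x) + / u ^ 2 * prim1 (u * x))
          (fun x => / u ^ 2 * prim0 (/ u * x) + / u * prim1 (/ u * x))).
        -- apply (is_derive_plus (fun x => / u * prim0 (u * x)) (fun x => / u ^ 2 * prim1 (u * x)));
             apply is_derive_scal, is_derive_scale_arg; [apply is_derive_prim0|apply is_derive_prim1]; lra.
        -- apply (is_derive_plus (fun x => / u ^ 2 * prim0 (/ u * x)) (fun x => / u * prim1 (/ u * x)));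
             apply is_derive_scal, is_derive_scale_arg; [apply is_derive_prim0|apply is_derive_prim1]; lra.
      * change (/ u * (u * / (1 + (u * x) ^ 3)) + / u ^ 2 * (u * (u * x / (1 + (u * x) ^ 3))) +
          (/ u ^ 2 * (/ u * / (1 + (/ u * x) ^ 3)) + / u * (/ u * (/ u * x / (1 + (/ u * x) ^ 3))))
          = (1 + x) * (/ (1 + u ^ 3 * x ^ 3) + / (x ^ 3 + u ^ 3))).
        replace (1 + (/ u * x) ^ 3) with ((x ^ 3 + u ^ 3) / u ^ 3) by (field; lra).
        replace (1 + (u * x) ^ 3) with (1 + u ^ 3 * x ^ 3) by ring.
        field. repeat split; lra.
    + apply (ex_derive_continuous (fun x => (1 + x) * (/ (1 + u ^ 3 * x ^ 3) + / (x ^ 3 + u ^ 3)))).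
      auto_derive. simpl in *. repeat split; lra.
  - unfold F. rewrite !Rmult_0_r, !Rmult_1_r.
    replace (prim0 0) with 0 by (symmetry; apply (RInt_point (V := R_CompleteNormedModule))).
    replace (prim1 0) with 0 by (symmetry; apply (RInt_point (V := R_CompleteNormedModule))).
    destruct (prim_inv u Hu) as [E0 E1].
    replace (prim0 (/ u)) with (c1 - prim1 u) by lra.
    replace (prim1 (/ u)) with (c1 - prim0 u) by lra. ring.
Qed.

Definition radial_integral (u : R) : R := RInt (fun x => ln (radial u x) * / cyclo6 x) 0 1.

Lemma is_derive_radial_integral_param (u : R) : 0 < u ->
  is_derive radial_integral u
    (RInt (fun x => (3 * u ^ 2 * x ^ 3 * (x ^ 3 + u ^ 3) + (1 + u ^ 3 * x ^ 3) * (3 * u ^ 2)) / radial u x * / cyclo6 x) 0 1).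
Proof.
  intros Hu.
  apply (is_derive_RInt_ln radial
    (fun u x => 3 * u ^ 2 * x ^ 3 * (x ^ 3 + u ^ 3) + (1 + u ^ 3 * x ^ 3) * (3 * u ^ 2)) (fun x => / cyclo6 x)).
  - intros y x. unfold radial. auto_derive. auto. ring.
  - intros y x. apply (ex_derive_continuous (radial y)). unfold radial. auto_derive. auto.
  - intros t _. apply continuous_inv_cyclo6.
  - intros t _. unfold radial. simpl.
    repeat first [apply continuity_2d_pt_plus | apply continuity_2d_pt_mult | apply continuity_2d_pt_const
      | apply continuity_2d_pt_id2 | apply continuity_2d_pt_id1 ].
  - intros t _. simpl.
    repeat first [apply continuity_2d_pt_plus | apply continuity_2d_pt_mult | apply continuity_2d_pt_const
      | apply continuity_2d_pt_id2 | apply continuity_2d_pt_id1 ].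
  - exists (mkposreal u Hu). intros y Hy t Ht. apply ball_Rabs in Hy; cbn [pos] in Hy.
    apply Rabs_def2 in Hy. destruct (radial_factors_pos y t ltac:(lra) ltac:(lra)).
    now apply Rmult_lt_0_compat.
Qed.

(** With [/ cyclo6 x = (1 + x) / (1 + x^3)], partial fractions rest on [(1 + x^3) - (1 + u^3 x^3) =
    (1 - u^3) x^3] and [(1 + x^3) - (x^3 + u^3) = 1 - u^3]. *)
Lemma is_derive_radial_integral (u : R) : 0 < u < 1 ->
  is_derive radial_integral u (3 * c1 * (1 + 2 * u) / (1 + u + u ^ 2)).
Proof.
  intros Hu. evar_last; [apply is_derive_radial_integral_param; lra|].
  assert (Hu3 : u ^ 3 < 1) by (simpl; nra).
  apply is_RInt_unique.
  replace (3 * c1 * (1 + 2 * u) / (1 + u + u ^ 2))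
    with (scal (3 * u ^ 2 / (1 - u ^ 3)) (minus (c1 * (/ u + / u ^ 2)) (scal 2 c1))).
  - apply (is_RInt_ext (fun x => scal (3 * u ^ 2 / (1 - u ^ 3))
      (minus ((1 + x) * (/ (1 + u ^ 3 * x ^ 3) + / (x ^ 3 + u ^ 3))) (scal 2 (/ cyclo6 x))))).
    + intros x Hx. rewrite Rmin_left, Rmax_right in Hx by lra.
      destruct (radial_factors_pos u x ltac:(lra) ltac:(lra)) as [P1 P2].
      pose proof (cyclo6_lower x) as HQ.
      change (3 * u ^ 2 / (1 - u ^ 3) * ((1 + x) * (/ (1 + u ^ 3 * x ^ 3) + / (x ^ 3 + u ^ 3)) - 2 * / cyclo6 x)
       = (3 * u ^ 2 * x ^ 3 * (x ^ 3 + u ^ 3) + (1 + u ^ 3 * x ^ 3) * (3 * u ^ 2)) / radial u x * / cyclo6 x).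
      unfold radial, cyclo6 in *. field. repeat split; lra.
    + apply (is_RInt_scal (V := R_NormedModule)), (is_RInt_minus (V := R_NormedModule)).
      * apply is_RInt_radial_kernel; lra.
      * apply (is_RInt_scal (V := R_NormedModule)), is_RInt_inv_cyclo6.
  - change (3 * u ^ 2 / (1 - u ^ 3) * (c1 * (/ u + / u ^ 2) - 2 * c1) = 3 * c1 * (1 + 2 * u) / (1 + u + u ^ 2)).
    field. repeat split; try lra; nra.
Qed.

Lemma radial_integral_value (u : R) : 0 < u <= 1 ->
  radial_integral 1 = radial_integral u + 3 * c1 * (ln 3 - ln (1 + u + u ^ 2)).
Proof.
  intros Hu.
  assert (Hln : forall x, 0 < x -> is_derive (fun u => 3 * c1 * ln (1 + u + u ^ 2)) x (3 * c1 * (1 + 2 * x) / (1 + x + x ^ 2))).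
  { intros x Hx. assert (0 < 1 + x + x ^ 2) by nra. auto_derive. simpl in *; lra. field. lra. }
  enough (E : radial_integral u - 3 * c1 * ln (1 + u + u ^ 2) = radial_integral 1 - 3 * c1 * ln (1 + 1 + 1 ^ 2)).
  { replace (1 + 1 + 1 ^ 2) with 3 in E by ring. lra. }
  apply (constant_of_derive_0 (fun u => radial_integral u - 3 * c1 * ln (1 + u + u ^ 2))); [lra| |]; intros x Hx.
  - evar_last.
    + apply (is_derive_minus radial_integral); [apply is_derive_radial_integral; lra|apply Hln; lra].
    + apply Rminus_diag_eq; reflexivity.
  - apply continuity_pt_filterlim, (ex_derive_continuous (fun u => radial_integral u - 3 * c1 * ln (1 + u + u ^ 2))).
    eexists. apply (is_derive_minus radial_integral); [apply is_derive_radial_integral_param; lra|apply Hln; lra].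
Qed.

(** * The radial integral at the origin *)

Definition inv_cyclo6_prim (x : R) : R := RInt (fun t => / cyclo6 t) 0 x.

Lemma is_derive_inv_cyclo6_prim (x : R) : -1 < x -> is_derive inv_cyclo6_prim x (/ cyclo6 x).
Proof. apply (is_derive_primitive (fun t => / cyclo6 t)). intros; apply continuous_inv_cyclo6. Qed.

Lemma inv_cyclo6_prim_0 : inv_cyclo6_prim 0 = 0.
Proof. apply (RInt_point (V := R_CompleteNormedModule)). Qed.

Lemma inv_cyclo6_prim_1 : inv_cyclo6_prim 1 = c1.
Proof. apply is_RInt_unique, is_RInt_inv_cyclo6. Qed.

(** Geometric sum of ratio [- x^3], as [/ cyclo6 x] is [(1 + x) / (1 + x^3)]. *)
Lemma inv_cyclo6_geometric (x : R) (N : nat) :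
  sum_n (fun n => (-1) ^ n * (x ^ (3 * n) + x ^ (3 * n + 1))) N =
  / cyclo6 x - (-1) ^ S N * x ^ (3 * S N) * / cyclo6 x :> R.
Proof.
  pose proof (cyclo6_lower x) as HQ.
  induction N as [|N IH].
  - rewrite sum_n_0. simpl. unfold cyclo6 in *. field. lra.
  - rewrite sum_n_S, IH. replace (3 * S (S N))%nat with (3 * S N + 3)%nat by lia.
    rewrite !pow_add, <- !tech_pow_Rmult. unfold cyclo6 in *. field. lra.
Qed.

Definition inv_cyclo6_prim_term (n : nat) (x : R) : R :=
  (-1) ^ n * (x ^ (3 * n + 1) / (3 * INR n + 1) + x ^ (3 * n + 2) / (3 * INR n + 2)).

Lemma inv_cyclo6_prim_approx (N : nat) (x : R) : 0 <= x <= 1 ->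
  Rabs (inv_cyclo6_prim x - sum_n (fun n => inv_cyclo6_prim_term n x) N) <= 4 / 3 * x ^ (3 * N + 4).
Proof.
  intros Hx.
  set (D := fun x => inv_cyclo6_prim x - sum_n (fun n => inv_cyclo6_prim_term n x) N).
  assert (Hd : forall y, 0 <= y -> is_derive D y ((-1) ^ S N * y ^ (3 * S N) * / cyclo6 y)).
  { intros y Hy. evar_last.
    - apply (is_derive_minus inv_cyclo6_prim (fun x => sum_n (fun n => inv_cyclo6_prim_term n x) N)).
      + apply is_derive_inv_cyclo6_prim; lra.
      + apply (is_derive_sum_n inv_cyclo6_prim_term N y (fun n => (-1) ^ n * (y ^ (3 * n) + y ^ (3 * n + 1)))).
        intros n _. unfold inv_cyclo6_prim_term. pose proof (pos_INR n).
        replace (3 * n + 2)%nat with (S (3 * n + 1)) by lia.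
        replace (3 * n + 1)%nat with (S (3 * n)) by lia.
        assert (E : INR (3 * n) = 3 * INR n) by (rewrite mult_INR; simpl; ring).
        generalize dependent (3 * n)%nat. intros e E.
        auto_derive. auto.
        change (match e with 0%nat => 1 | S _ => INR e + 1 end) with (INR (S e)).
        rewrite S_INR, E. simpl pow. field. lra.
    - change (/ cyclo6 y - sum_n (fun n => (-1) ^ n * (y ^ (3 * n) + y ^ (3 * n + 1))) N =
        (-1) ^ S N * y ^ (3 * S N) * / cyclo6 y :> R).
      rewrite inv_cyclo6_geometric. ring. }
  destruct (MVT_gen D 0 x (fun y => (-1) ^ S N * y ^ (3 * S N) * / cyclo6 y)) as (c & Hc & E).
  - intros y Hy. rewrite Rmin_left, Rmax_right in Hy by lra. apply Hd; lra.
  - intros y Hy. rewrite Rmin_left, Rmax_right in Hy by lra.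
    apply continuity_pt_filterlim, (ex_derive_continuous D). eexists. apply Hd; lra.
  - rewrite Rmin_left, Rmax_right in Hc by lra.
    assert (D0 : D 0 = 0).
    { unfold D. rewrite inv_cyclo6_prim_0. clear.
      assert (E : sum_n (fun n => inv_cyclo6_prim_term n 0) N = 0 :> R); [|rewrite E; ring].
      assert (Ht : forall n, inv_cyclo6_prim_term n 0 = 0).
      { intros n. unfold inv_cyclo6_prim_term. rewrite !pow_ne_zero by lia. unfold Rdiv. ring. }
      induction N as [|m IH]; [rewrite sum_n_0|rewrite sum_n_S, IH]; rewrite Ht; ring. }
    fold (D x). replace (D x) with (D x - D 0) by (rewrite D0; ring). rewrite E, Rminus_0_r.
    rewrite !Rabs_mult, pow_1_abs, Rmult_1_l.
    pose proof (cyclo6_inv_bounds c).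
    assert (0 <= c ^ (3 * S N)) by (apply pow_le; lra).
    assert (c ^ (3 * S N) <= x ^ (3 * S N)) by (apply pow_incr; lra).
    rewrite !Rabs_pos_eq by lra.
    replace (3 * N + 4)%nat with (3 * S N + 1)%nat by lia. rewrite pow_add, pow_1.
    rewrite <- Rmult_assoc. apply Rmult_le_compat_r; [lra|].
    rewrite Rmult_comm. apply Rmult_le_compat; lra.
Qed.

(** Term of the sum [K]; the integral of [ln x / cyclo6 x] over [[0, 1]] is [- K], as [x^k ln x]
    integrates to [- 1 / (k+1)^2]. *)
Definition kappa (n : nat) : R := (-1) ^ n * (/ (3 * INR n + 1) ^ 2 + / (3 * INR n + 2) ^ 2).

Lemma is_RInt_pow (n : nat) : is_RInt (fun x => x ^ n) 0 1 (/ (INR n + 1)).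
Proof.
  pose proof (pos_INR n).
  replace (/ (INR n + 1)) with (1 ^ S n / (INR n + 1) - 0 ^ S n / (INR n + 1)).
  - apply (is_RInt_derive_le (fun x => x ^ S n / (INR n + 1))); [lra| |]; intros x _.
    + auto_derive. auto. change (match n with 0%nat => 1 | S _ => INR n + 1 end) with (INR (S n)).
      rewrite S_INR. field. lra.
    + apply (ex_derive_continuous (fun x => x ^ n)). auto_derive. auto.
  - rewrite pow1, pow_ne_zero by lia. field. lra.
Qed.

Lemma is_RInt_sum_n (f : nat -> R -> R) (l : nat -> R) (a b : R) (N : nat) :
  (forall n, (n <= N)%nat -> is_RInt (f n) a b (l n)) ->
  is_RInt (fun x => sum_n (fun n => f n x) N) a b (sum_n l N).
Proof.
  induction N as [|N IH]; intros H.
  - apply (is_RInt_ext (f 0%nat)).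
    + intros x _. now rewrite sum_n_0.
    + rewrite sum_n_0. apply H; lia.
  - apply (is_RInt_ext (fun x => plus (sum_n (fun n => f n x) N) (f (S N) x))).
    + intros x _. now rewrite sum_n_S.
    + rewrite sum_n_S. apply (is_RInt_plus (V := R_NormedModule)); [apply IH; intros|]; apply H; lia.
Qed.

(** This is [3 / x] times [inv_cyclo6_prim_term n x], where [3 / x] is the limit at [u = 0] of the
    logarithmic derivative of [radial u]. *)
Definition kappa_integrand (n : nat) (x : R) : R :=
  3 * ((-1) ^ n * (x ^ (3 * n) / (3 * INR n + 1) + x ^ (3 * n + 1) / (3 * INR n + 2))).

Lemma is_RInt_kappa_integrand (n : nat) : is_RInt (kappa_integrand n) 0 1 (3 * kappa n).
Proof.
  pose proof (pos_INR n).
  assert (E : INR (3 * n) = 3 * INR n) by (rewrite mult_INR; simpl; ring).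
  assert (E1 : INR (3 * n + 1) = 3 * INR n + 1) by (rewrite plus_INR, E; reflexivity).
  replace (3 * kappa n) with (scal (3 * (-1) ^ n)
    (plus (scal (/ (3 * INR n + 1)) (/ (INR (3 * n) + 1))) (scal (/ (3 * INR n + 2)) (/ (INR (3 * n + 1) + 1))))).
  - apply (is_RInt_ext (fun x => scal (3 * (-1) ^ n)
      (plus (scal (/ (3 * INR n + 1)) (x ^ (3 * n))) (scal (/ (3 * INR n + 2)) (x ^ (3 * n + 1)))))).
    + intros x _. unfold kappa_integrand.
      change (3 * (-1) ^ n * (/ (3 * INR n + 1) * x ^ (3 * n) + / (3 * INR n + 2) * x ^ (3 * n + 1)) =
       3 * ((-1) ^ n * (x ^ (3 * n) / (3 * INR n + 1) + x ^ (3 * n + 1) / (3 * INR n + 2)))). field; lra.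
    + apply (is_RInt_scal (V := R_NormedModule)), (is_RInt_plus (V := R_NormedModule));
        apply (is_RInt_scal (V := R_NormedModule)), is_RInt_pow.
  - rewrite E, E1. unfold kappa.
    change (3 * (-1) ^ n * (/ (3 * INR n + 1) * / (3 * INR n + 1) + / (3 * INR n + 2) * / (3 * INR n + 1 + 1)) =
     3 * ((-1) ^ n * (/ (3 * INR n + 1) ^ 2 + / (3 * INR n + 2) ^ 2))). field; lra.
Qed.

(** The left side is the relative error of [3 / x] as a substitute for [3 x^2 / (x^3 + u^3)]; the
    right side has an elementary integral. The 4 comes from [(x+u)^3 <= 4 (x^3 + u^3)]. *)
Lemma cube_kernel_bound (u x : R) : 0 < u -> 0 <= x ->
  u ^ 3 / (x ^ 3 + u ^ 3) <= 4 * (u ^ 2 * / (x + u) ^ 2).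
Proof.
  intros Hu Hx. destruct (radial_factors_pos u x Hu Hx) as [_ P].
  assert (Hxu : 0 < (x + u) ^ 2) by (apply pow_lt; lra).
  apply (Rmult_le_reg_r ((x ^ 3 + u ^ 3) * (x + u) ^ 2)); [now apply Rmult_lt_0_compat|].
  replace (u ^ 3 / (x ^ 3 + u ^ 3) * ((x ^ 3 + u ^ 3) * (x + u) ^ 2)) with (u ^ 2 * (u * (x + u) ^ 2)) by (field; lra).
  replace (4 * (u ^ 2 * / (x + u) ^ 2) * ((x ^ 3 + u ^ 3) * (x + u) ^ 2)) with (u ^ 2 * (4 * (x ^ 3 + u ^ 3))) by (field; lra).
  apply Rmult_le_compat_l; [apply pow2_ge_0|].
  assert (0 <= (x + u) * ((x - u) ^ 2 * 3 + x * x)) by (apply Rmult_le_pos; [lra|pose proof (pow2_ge_0 (x - u)); nra]).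
  assert (0 <= x * u * u) by (repeat apply Rmult_le_pos; lra).
  assert (0 <= x * x * u) by (repeat apply Rmult_le_pos; lra).
  nra.
Qed.

Lemma is_RInt_square_kernel (u : R) : 0 < u ->
  is_RInt (fun x => u ^ 2 * / (x + u) ^ 2) 0 1 (u / (1 + u)).
Proof.
  intros Hu.
  replace (u / (1 + u)) with (- u ^ 2 * / (1 + u) - - u ^ 2 * / (0 + u)) by (field; lra).
  apply (is_RInt_derive_le (fun x => - u ^ 2 * / (x + u))); [lra| |]; intros x Hx.
  - auto_derive. lra. field. lra.
  - apply (ex_derive_continuous (fun x => u ^ 2 * / (x + u) ^ 2)). auto_derive.
    apply Rgt_not_eq. assert (0 < x + u) by lra. nra.
Qed.

(* [k * d/dx ln (radial u x)] with [k = inv_cyclo6_prim], the integrand left by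
   integrating [radial_integral u] by parts. *)
Definition radial_parts (u x : R) : R :=
  inv_cyclo6_prim x * (3 * u ^ 3 * x ^ 2 / (1 + u ^ 3 * x ^ 3) + 3 * x ^ 2 / (x ^ 3 + u ^ 3)).

Lemma continuous_radial_parts (u x : R) : 0 < u -> 0 <= x -> continuous (radial_parts u) x.
Proof.
  intros Hu Hx. destruct (radial_factors_pos u x Hu Hx).
  apply (continuous_mult inv_cyclo6_prim).
  - apply (ex_derive_continuous inv_cyclo6_prim). eexists. apply is_derive_inv_cyclo6_prim. lra.
  - apply (ex_derive_continuous (fun x => 3 * u ^ 3 * x ^ 2 / (1 + u ^ 3 * x ^ 3) + 3 * x ^ 2 / (x ^ 3 + u ^ 3))).
    auto_derive. simpl in *. repeat split; lra.
Qed.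

(** As [u] tends to 0, [ln (radial u x)] becomes singular at [x = 0]. Integration by parts with the
    primitive that vanishes at 0 compensates the resulting pole [3 / x]. *)
Lemma is_RInt_radial_parts (u : R) : 0 < u ->
  is_RInt (radial_parts u) 0 1 (2 * c1 * ln (1 + u ^ 3) - radial_integral u).
Proof.
  intros Hu. assert (0 < u ^ 3) by now apply pow_lt.
  set (dl := fun x => 3 * u ^ 3 * x ^ 2 / (1 + u ^ 3 * x ^ 3) + 3 * x ^ 2 / (x ^ 3 + u ^ 3)).
  assert (Hdl : forall x, 0 <= x -> is_derive (fun x => ln (radial u x)) x (dl x)).
  { intros x Hx. destruct (radial_factors_pos u x Hu Hx) as [P1 P2]. unfold radial, dl.
    auto_derive. simpl in *. apply Rmult_lt_0_compat; lra. field. simpl in *. repeat split; lra. }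
  assert (Hc : forall x, 0 <= x -> continuous (fun x => ln (radial u x) * / cyclo6 x) x).
  { intros x Hx. apply (continuous_mult (fun x => ln (radial u x))); [|apply continuous_inv_cyclo6].
    apply (ex_derive_continuous (fun x => ln (radial u x))). eexists. now apply Hdl. }
  assert (H1 : is_RInt (fun x => ln (radial u x) * / cyclo6 x + radial_parts u x) 0 1
    (inv_cyclo6_prim 1 * ln (radial u 1) - inv_cyclo6_prim 0 * ln (radial u 0))).
  { apply (is_RInt_derive_le (fun x => inv_cyclo6_prim x * ln (radial u x))); [lra| |]; intros x Hx.
    - evar_last.
      + apply (is_derive_mult inv_cyclo6_prim (fun x => ln (radial u x))).
        * apply is_derive_inv_cyclo6_prim; lra.
        * apply Hdl; lra.
        * intros; apply Rmult_comm.
      + change (/ cyclo6 x * ln (radial u x) + inv_cyclo6_prim x * dl x = ln (radial u x) * / cyclo6 x + inv_cyclo6_prim x * dl x). ring.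
    - apply (continuous_plus (fun x => ln (radial u x) * / cyclo6 x)); [apply Hc; lra|].
      apply continuous_radial_parts; lra. }
  assert (H2 : is_RInt (fun x => ln (radial u x) * / cyclo6 x) 0 1 (radial_integral u)).
  { apply RInt_correct_R, ex_RInt_continuous_le; [lra|]. intros; apply Hc; lra. }
  replace (2 * c1 * ln (1 + u ^ 3) - radial_integral u) with
    (minus (inv_cyclo6_prim 1 * ln (radial u 1) - inv_cyclo6_prim 0 * ln (radial u 0)) (radial_integral u)).
  - apply (is_RInt_ext (fun x => minus (ln (radial u x) * / cyclo6 x + radial_parts u x) (ln (radial u x) * / cyclo6 x))).
    + intros x _. change (ln (radial u x) * / cyclo6 x + radial_parts u x - ln (radial u x) * / cyclo6 x = radial_parts u x). ring.
    + now apply (is_RInt_minus (V := R_NormedModule)).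
  - rewrite inv_cyclo6_prim_0, inv_cyclo6_prim_1. unfold radial.
    replace ((1 + u ^ 3 * 1 ^ 3) * (1 ^ 3 + u ^ 3)) with ((1 + u ^ 3) * (1 + u ^ 3)) by ring.
    rewrite ln_mult by lra.
    change (c1 * (ln (1 + u ^ 3) + ln (1 + u ^ 3)) - 0 * ln ((1 + u ^ 3 * 0 ^ 3) * (0 ^ 3 + u ^ 3)) - radial_integral u =
      2 * c1 * ln (1 + u ^ 3) - radial_integral u). ring.
Qed.

(** Three errors, in order: truncation of the primitive, where [x W <= 3] absorbs one power of [x];
    replacement of [W] by [3 / x] in [2 (N + 1)] monomials at [12 d] each; and the part
    [V <= 3 u^3], multiplied by a primitive of size at most [4 / 3]. *)
Lemma radial_parts_approx (u x : R) (N : nat) : 0 < u -> 0 <= x <= 1 ->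
  Rabs (radial_parts u x - sum_n (fun n => kappa_integrand n x) N) <=
  4 * x ^ (3 * N + 3) + 24 * (INR N + 1) * (u ^ 2 * / (x + u) ^ 2) + 4 * u ^ 3.
Proof.
  intros Hu Hx. destruct (radial_factors_pos u x Hu ltac:(lra)) as [P1 P2].
  assert (Hu3 : 0 < u ^ 3) by now apply pow_lt.
  assert (Hx3 : 0 <= x ^ 3) by (apply pow_le; lra).
  assert (Hx2 : 0 <= x ^ 2 <= 1) by nra.
  set (W := 3 * x ^ 2 / (x ^ 3 + u ^ 3)).
  set (V := 3 * u ^ 3 * x ^ 2 / (1 + u ^ 3 * x ^ 3)).
  set (d := u ^ 2 * / (x + u) ^ 2).
  assert (HW : 0 <= W) by (apply Rmult_le_pos; [lra|apply Rlt_le, Rinv_0_lt_compat; lra]).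
  assert (HV : 0 <= V <= 3 * u ^ 3).
  { split; [apply Rmult_le_pos; [nra|apply Rlt_le, Rinv_0_lt_compat; lra]|].
    apply (Rmult_le_reg_r (1 + u ^ 3 * x ^ 3)); [lra|]. unfold V.
    replace (3 * u ^ 3 * x ^ 2 / (1 + u ^ 3 * x ^ 3) * (1 + u ^ 3 * x ^ 3)) with (3 * u ^ 3 * x ^ 2) by (field; lra).
    assert (0 <= u ^ 3 * x ^ 3) by nra. nra. }
  assert (Hk : Rabs (inv_cyclo6_prim x) <= 4 / 3).
  { destruct (MVT_gen inv_cyclo6_prim 0 x (fun x => / cyclo6 x)) as (c & Hc & E).
    - intros y Hy. rewrite Rmin_left, Rmax_right in Hy by lra. apply is_derive_inv_cyclo6_prim; lra.
    - intros y Hy. rewrite Rmin_left, Rmax_right in Hy by lra.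
      apply continuity_pt_filterlim, (ex_derive_continuous inv_cyclo6_prim). eexists. apply is_derive_inv_cyclo6_prim; lra.
    - rewrite inv_cyclo6_prim_0, !Rminus_0_r in E. rewrite E. pose proof (cyclo6_inv_bounds c).
      rewrite Rabs_pos_eq by nra. nra. }
  assert (Hm : forall j, Rabs (x ^ (j + 1) * W - 3 * x ^ j) <= 12 * d).
  { intros j. assert (0 <= x ^ j <= 1).
    { split; [apply pow_le; lra|]. rewrite <- (pow1 j). apply pow_incr; lra. }
    replace (x ^ (j + 1) * W - 3 * x ^ j) with (- (3 * (x ^ j * (u ^ 3 / (x ^ 3 + u ^ 3))))).
    2:{ unfold W. rewrite pow_add, pow_1. field. lra. }
    pose proof (cube_kernel_bound u x Hu ltac:(lra)) as Hb. fold d in Hb.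
    assert (0 <= u ^ 3 / (x ^ 3 + u ^ 3)) by (apply Rmult_le_pos; [lra|apply Rlt_le, Rinv_0_lt_compat; lra]).
    rewrite Rabs_Ropp, Rabs_pos_eq by (apply Rmult_le_pos; [lra|apply Rmult_le_pos; lra]). nra. }
  assert (Hs : Rabs (sum_n (fun n => inv_cyclo6_prim_term n x) N * W - sum_n (fun n => kappa_integrand n x) N)
    <= 24 * (INR N + 1) * d).
  { assert (Ht : forall n, Rabs (inv_cyclo6_prim_term n x * W - kappa_integrand n x) <= 24 * d).
    { intros n. unfold inv_cyclo6_prim_term, kappa_integrand. pose proof (pos_INR n).
      replace (3 * n + 2)%nat with (3 * n + 1 + 1)%nat by lia.
      replace ((-1) ^ n * (x ^ (3 * n + 1) / (3 * INR n + 1) + x ^ (3 * n + 1 + 1) / (3 * INR n + 2)) * W -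
        3 * ((-1) ^ n * (x ^ (3 * n) / (3 * INR n + 1) + x ^ (3 * n + 1) / (3 * INR n + 2))))
      with ((-1) ^ n * (/ (3 * INR n + 1) * (x ^ (3 * n + 1) * W - 3 * x ^ (3 * n)) +
         / (3 * INR n + 2) * (x ^ (3 * n + 1 + 1) * W - 3 * x ^ (3 * n + 1)))) by (field; lra).
      rewrite Rabs_mult, pow_1_abs, Rmult_1_l.
      eapply Rle_trans; [apply Rabs_triang|]. rewrite !Rabs_mult.
      assert (0 < / (3 * INR n + 1) <= 1).
      { split; [apply Rinv_0_lt_compat; lra|]. rewrite <- Rinv_1. apply Rinv_le_contravar; lra. }
      assert (0 < / (3 * INR n + 2) <= 1).
      { split; [apply Rinv_0_lt_compat; lra|]. rewrite <- Rinv_1. apply Rinv_le_contravar; lra. }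
      rewrite (Rabs_pos_eq (/ (3 * INR n + 1))), (Rabs_pos_eq (/ (3 * INR n + 2))) by lra.
      pose proof (Hm (3 * n)%nat). pose proof (Hm (3 * n + 1)%nat).
      pose proof (Rabs_pos (x ^ (3 * n + 1) * W - 3 * x ^ (3 * n))).
      pose proof (Rabs_pos (x ^ (3 * n + 1 + 1) * W - 3 * x ^ (3 * n + 1))). nra. }
    clear -Ht. induction N as [|N IH].
    - rewrite !sum_n_0. specialize (Ht 0%nat). simpl INR. lra.
    - rewrite !sum_n_S, S_INR. specialize (Ht (S N)).
      replace ((sum_n (fun n => inv_cyclo6_prim_term n x) N + inv_cyclo6_prim_term (S N) x) * W -
        (sum_n (fun n => kappa_integrand n x) N + kappa_integrand (S N) x))
      with ((sum_n (fun n => inv_cyclo6_prim_term n x) N * W - sum_n (fun n => kappa_integrand n x) N)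
       + (inv_cyclo6_prim_term (S N) x * W - kappa_integrand (S N) x)) by ring.
      eapply Rle_trans; [apply Rabs_triang|]. lra. }
  pose proof (inv_cyclo6_prim_approx N x Hx) as Ha.
  change (radial_parts u x) with (inv_cyclo6_prim x * (V + W)).
  replace (inv_cyclo6_prim x * (V + W) - sum_n (fun n => kappa_integrand n x) N) with
    ((inv_cyclo6_prim x - sum_n (fun n => inv_cyclo6_prim_term n x) N) * W +
     (sum_n (fun n => inv_cyclo6_prim_term n x) N * W - sum_n (fun n => kappa_integrand n x) N) +
     inv_cyclo6_prim x * V) by ring.
  eapply Rle_trans; [apply Rabs_triang|]. apply Rplus_le_compat.
  - eapply Rle_trans; [apply Rabs_triang|]. apply Rplus_le_compat; [|apply Hs].
    rewrite Rabs_mult, (Rabs_pos_eq W) by lra.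
    apply Rle_trans with (4 / 3 * x ^ (3 * N + 4) * W); [apply Rmult_le_compat_r; lra|].
    replace (3 * N + 4)%nat with (3 * N + 3 + 1)%nat by lia. rewrite pow_add, pow_1.
    assert (0 <= x ^ (3 * N + 3)) by (apply pow_le; lra).
    assert (x * W <= 3).
    { unfold W. apply (Rmult_le_reg_r (x ^ 3 + u ^ 3)); [lra|].
      replace (x * (3 * x ^ 2 / (x ^ 3 + u ^ 3)) * (x ^ 3 + u ^ 3)) with (3 * x ^ 3) by (field; lra). lra. }
    nra.
  - rewrite Rabs_mult, (Rabs_pos_eq V) by lra. pose proof (Rabs_pos (inv_cyclo6_prim x)). nra.
Qed.

Lemma c1_pos : 0 < c1.
Proof. unfold c1. pose proof PI_RGT_0. pose proof sqrt3_pos. assert (0 < PI * sqrt 3) by nra. nra. Qed.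

Lemma radial_integral_approx (u : R) (N : nat) : 0 < u <= 1 ->
  Rabs (radial_integral u + 3 * sum_n kappa N) <=
  (2 * c1 + 4 + 24 * (INR N + 1)) * u + 4 * / (3 * INR N + 4).
Proof.
  intros Hu. pose proof c1_pos. pose proof (pos_INR N).
  assert (Hu3 : 0 < u ^ 3 <= u).
  { split; [apply pow_lt; lra|]. simpl. assert (u * u <= 1) by nra. nra. }
  assert (H1 := is_RInt_minus _ _ _ _ _ _ (is_RInt_radial_parts u ltac:(lra))
    (is_RInt_sum_n kappa_integrand (fun n => 3 * kappa n) 0 1 N (fun n _ => is_RInt_kappa_integrand n))).
  assert (H2 := is_RInt_plus _ _ _ _ _ _ (is_RInt_plus _ _ _ _ _ _
      (is_RInt_scal _ _ _ 4 _ (is_RInt_pow (3 * N + 3)))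
      (is_RInt_scal _ _ _ (24 * (INR N + 1)) _ (is_RInt_square_kernel u ltac:(lra))))
      (is_RInt_const 0 1 (4 * u ^ 3))).
  (* The pointwise bound stays abstracted as [H]; the integrands are inferred from [H1] and [H2]. *)
  assert (Hn := fun H => norm_RInt_le _ _ _ _ _ _ Rle_0_1 H H1 H2).
  assert (Hsum : sum_n (fun n => 3 * kappa n) N = 3 * sum_n kappa N :> R).
  { exact (sum_n_mult_l (K := R_Ring) 3 kappa N). }
  match type of Hn with _ -> norm ?l <= ?r =>
    change (norm l) with (Rabs (2 * c1 * ln (1 + u ^ 3) - radial_integral u - sum_n (fun n => 3 * kappa n) N)) in Hn;
    change r with (4 * / (INR (3 * N + 3) + 1) + 24 * (INR N + 1) * (u / (1 + u)) + (1 - 0) * (4 * u ^ 3)) in Hn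
  end.
  rewrite Hsum in Hn.
  assert (Hb : Rabs (2 * c1 * ln (1 + u ^ 3) - radial_integral u - 3 * sum_n kappa N) <=
     4 * / (3 * INR N + 4) + 24 * (INR N + 1) * u + 4 * u).
  { eapply Rle_trans; [apply Hn|].
    - intros x Hx. apply (radial_parts_approx u x N); lra.
    - replace (INR (3 * N + 3) + 1) with (3 * INR N + 4) by (rewrite plus_INR, mult_INR; simpl; ring).
      assert (u / (1 + u) <= u).
      { apply (Rmult_le_reg_r (1 + u)); [lra|]. unfold Rdiv. rewrite Rmult_assoc, Rinv_l by lra. nra. }
      assert (24 * (INR N + 1) * (u / (1 + u)) <= 24 * (INR N + 1) * u) by (apply Rmult_le_compat_l; lra).
      lra. }
  assert (Hl : 0 <= ln (1 + u ^ 3) <= u).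
  { split. rewrite <- ln_1. apply ln_le; lra.
    apply Rle_trans with (1 + u ^ 3 - 1); [|lra].
    pose proof (exp_ineq1_le (u ^ 3)). rewrite <- (ln_exp (1 + u ^ 3 - 1)). apply ln_le; [lra|].
    replace (1 + u ^ 3 - 1) with (u ^ 3) by ring. lra. }
  replace (radial_integral u + 3 * sum_n kappa N) with
    (2 * c1 * ln (1 + u ^ 3) + - (2 * c1 * ln (1 + u ^ 3) - radial_integral u - 3 * sum_n kappa N)) by ring.
  eapply Rle_trans; [apply Rabs_triang|]. rewrite Rabs_Ropp, (Rabs_pos_eq (2 * c1 * _)) by nra. nra.
Qed.

(** The limits are taken in order: for fixed [N], letting [u] tend to 0 removes all errors of
    [radial_integral_approx] but [4 / (3 N + 4)], and then [N] grows. *)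
Theorem is_series_kappa : is_series kappa (c1 * ln 3 - radial_integral 1 / 3).
Proof.
  pose proof c1_pos as Hc1.
  assert (H : forall N, Rabs (radial_integral 1 - 3 * c1 * ln 3 + 3 * sum_n kappa N) <= 4 * / (3 * INR N + 4)).
  { intros N. pose proof (pos_INR N). apply le_epsilon. intros eps Heps.
    (* The summand [6 * c1] accounts for [3 c1 ln (1 + u + u^2) <= 6 c1 u]. *)
    set (A := 2 * c1 + 4 + 24 * (INR N + 1) + 6 * c1).
    assert (HA : 0 < A) by (unfold A; lra).
    set (u := Rmin 1 (eps / A)).
    assert (Hu : 0 < u <= 1).
    { split; [apply Rmin_pos; [lra|apply Rdiv_lt_0_compat; lra]|apply Rmin_l]. }
    assert (HuA : A * u <= eps).
    { apply Rle_trans with (A * (eps / A)); [apply Rmult_le_compat_l; [lra|apply Rmin_r]|right; field; lra]. }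
    rewrite (radial_integral_value u Hu).
    pose proof (radial_integral_approx u N Hu) as Ha.
    assert (Hl : 0 <= ln (1 + u + u ^ 2) <= 2 * u).
    { assert (0 <= u ^ 2 <= u) by nra. split. rewrite <- ln_1. apply ln_le; lra.
      pose proof (exp_ineq1_le (2 * u)). rewrite <- (ln_exp (2 * u)). apply ln_le; lra. }
    replace (radial_integral u + 3 * c1 * (ln 3 - ln (1 + u + u ^ 2)) - 3 * c1 * ln 3 + 3 * sum_n kappa N)
      with ((radial_integral u + 3 * sum_n kappa N) + - (3 * c1 * ln (1 + u + u ^ 2))) by ring.
    eapply Rle_trans; [apply Rabs_triang|]. rewrite Rabs_Ropp, (Rabs_pos_eq (3 * c1 * _)) by nra.
    unfold A in HuA. nra. }
  apply is_lim_seq_sum_n.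
  apply (is_lim_seq_ext (fun N => (c1 * ln 3 - radial_integral 1 / 3) + (sum_n kappa N - (c1 * ln 3 - radial_integral 1 / 3)))).
  { intros N. ring. }
  replace (Finite (c1 * ln 3 - radial_integral 1 / 3)) with (Finite (c1 * ln 3 - radial_integral 1 / 3 + 0)) at 1 by (f_equal; ring).
  apply is_lim_seq_plus'; [apply is_lim_seq_const|].
  apply is_lim_seq_abs_0.
  apply is_lim_seq_le_le with (fun _ => 0) (fun N => 4 * / (3 * INR N + 4)).
  - intros N. split; [apply Rabs_pos|]. specialize (H N).
    replace (sum_n kappa N - (c1 * ln 3 - radial_integral 1 / 3)) with
      (/ 3 * (radial_integral 1 - 3 * c1 * ln 3 + 3 * sum_n kappa N)) by field.
    rewrite Rabs_mult, Rabs_pos_eq by lra.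
    pose proof (Rabs_pos (radial_integral 1 - 3 * c1 * ln 3 + 3 * sum_n kappa N)). lra.
  - apply is_lim_seq_const.
  - replace (Finite 0) with (Finite (4 * 0)) by (f_equal; ring).
    apply (is_lim_seq_scal_l _ 4 0). apply is_lim_seq_inv_linear; lra.
Qed.

(** * Residue classes modulo 6 *)

Lemma sum_lt_ext (f g : nat -> R) (n : nat) :
  (forall k, (k < n)%nat -> f k = g k) -> sum_lt f n = sum_lt g n.
Proof.
  induction n as [|n IH]; intros E; [reflexivity|].
  rewrite !sum_lt_S, IH, E; auto.
Qed.

Lemma sum_lt_add (f : nat -> R) (n k : nat) :
  sum_lt f (n + k) = sum_lt f n + sum_lt (fun j => f (n + j)%nat) k.
Proof.
  induction k as [|k IH].
  - rewrite Nat.add_0_r. simpl. ring.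
  - rewrite Nat.add_succ_r, !sum_lt_S, IH. ring.
Qed.

(** The partial sums of the blocks are a subsequence of the original partial sums. *)
Lemma is_series_group (a : nat -> R) (l : R) (q : nat) : (0 < q)%nat ->
  is_series a l -> is_series (fun n => sum_lt (fun j => a (q * n + j)%nat) q) l.
Proof.
  intros Hq Ha. apply is_lim_seq_sum_n.
  apply (is_lim_seq_ext (fun n => sum_n a (q * S n - 1))).
  - intros n. change (sum_n a (q * S n - 1)) with (sum_lt a (S (q * S n - 1))).
    replace (S (q * S n - 1)) with (q * S n)%nat by lia.
    induction n as [|n IH].
    + rewrite sum_n_0, Nat.mul_1_r. apply sum_lt_ext. intros. f_equal. lia.
    + rewrite sum_n_S, <- IH. replace (q * S (S n))%nat with (q * S n + q)%nat by lia. apply sum_lt_add.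
  - apply (is_lim_seq_subseq (sum_n a) l (fun n => q * S n - 1)%nat); [|exact Ha].
    apply eventually_subseq. intros n. nia.
Qed.

Definition mod6_term (r : R) (n : nat) : R := / (6 * INR n + r) ^ 2.

Lemma is_series_mod6 (r : R) : 0 < r < 6 -> is_series (mod6_term r) (trigamma (r / 6) / 36).
Proof.
  intros Hr.
  rewrite trigamma_series by lra.
  assert (H := Series_correct _ (ex_series_inv_square_shift (r / 6) ltac:(lra))).
  assert (H0 : is_series (fun n => / (INR n + r / 6) ^ 2) (/ (r / 6) ^ 2 + Series (fun k => / (INR (S k) + r / 6) ^ 2))).
  { apply is_series_decr_1.
    change (is_series (fun k => / (INR (S k) + r / 6) ^ 2)
      (/ (r / 6) ^ 2 + Series (fun k => / (INR (S k) + r / 6) ^ 2) - / (0 + r / 6) ^ 2)).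
    rewrite Rplus_0_l. unfold Rminus. rewrite (Rplus_comm (/ (r / 6) ^ 2)), Rplus_assoc, Rplus_opp_r, Rplus_0_r.
    exact H. }
  apply (is_series_scal_r (/ 36)) in H0.
  eapply is_series_ext_R; [|exact H0].
  intros n. unfold mod6_term. pose proof (pos_INR n). cbn beta. field. lra.
Qed.

(** Pairs of terms of [K] give residues 1, 2 with plus and 4, 5 with minus. The full series, its
    multiples of 3 and its even part give three linear relations; they yield [z1 + z5 = 2 z / 3] and
    [z2 + z4 = 2 z / 9], the reflection formulas at [1 / 6] and [1 / 3], which eliminate [z1] and
    [z4]. *)
Lemma kappa_value (K : R) : is_series kappa K ->
  K = 2 * PI ^ 2 / 27 - (trigamma (5 / 6) - trigamma (1 / 3)) / 18.
Proof.
  intros HK.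
  assert (H1 := is_series_mod6 1 ltac:(lra)). assert (H2 := is_series_mod6 2 ltac:(lra)).
  assert (H3 := is_series_mod6 3 ltac:(lra)). assert (H4 := is_series_mod6 4 ltac:(lra)).
  assert (H5 := is_series_mod6 5 ltac:(lra)).
  replace (2 / 6) with (1 / 3) in H2 by field.
  set (z1 := trigamma (1 / 6) / 36) in *. set (z2 := trigamma (1 / 3) / 36) in *.
  set (z3 := trigamma (3 / 6) / 36) in *. set (z4 := trigamma (4 / 6) / 36) in *.
  set (z5 := trigamma (5 / 6) / 36) in *. set (z := PI ^ 2 / 6).
  assert (Hz : is_series (fun n => / INR (S n) ^ 2) z) by apply basel.
  assert (H6 : is_series (mod6_term 6) (z * / 36)).
  { apply is_series_scal_r with (c := / 36) in Hz. eapply is_series_ext_R; [|exact Hz].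
    intros n. unfold mod6_term. rewrite S_INR. pose proof (pos_INR n). cbn beta. field. lra. }
  assert (E1 : K = z1 + z2 - z4 - z5).
  { apply (is_series_group _ _ 2 ltac:(lia)) in HK.
    assert (Hs := is_series_minus_R _ _ _ _ (is_series_minus_R _ _ _ _ (is_series_plus_R _ _ _ _ H1 H2) H4) H5).
    apply is_series_unique in HK. apply is_series_unique in Hs.
    rewrite <- HK. rewrite <- Hs.
    apply Series_ext. intros n. unfold sum_lt. rewrite sum_n_S, sum_n_0.
    unfold kappa, mod6_term. pose proof (pos_INR n).
    rewrite Nat.add_0_r, pow_add, pow_1_even, plus_INR, mult_INR. simpl INR.
    replace (3 * ((1 + 1) * INR n)) with (6 * INR n) by ring.
    replace (3 * ((1 + 1) * INR n + 1) + 1) with (6 * INR n + 4) by ring.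
    replace (3 * ((1 + 1) * INR n + 1) + 2) with (6 * INR n + 5) by ring. ring. }
  assert (E2 : z = z1 + z2 + z3 + z4 + z5 + z * / 36).
  { assert (Hg := is_series_group _ _ 6 ltac:(lia) Hz).
    assert (Hs := is_series_plus_R _ _ _ _ (is_series_plus_R _ _ _ _ (is_series_plus_R _ _ _ _
      (is_series_plus_R _ _ _ _ (is_series_plus_R _ _ _ _ H1 H2) H3) H4) H5) H6).
    apply is_series_unique in Hg. apply is_series_unique in Hs.
    rewrite <- Hg at 1.
    rewrite <- Hs.
    apply Series_ext. intros n. unfold sum_lt. rewrite !sum_n_S, sum_n_0.
    unfold mod6_term.
    rewrite !S_INR, !plus_INR, !mult_INR. simpl INR.
    repeat apply (f_equal2 Rplus); do 2 f_equal; ring. }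
  assert (E3 : z * / 9 = z3 + z * / 36).
  { assert (Hg := is_series_scal_r (/ 9) _ _ Hz).
    apply (is_series_group _ _ 2 ltac:(lia)) in Hg.
    assert (Hs := is_series_plus_R _ _ _ _ H3 H6).
    apply is_series_unique in Hg. apply is_series_unique in Hs.
    rewrite <- Hg. rewrite <- Hs.
    apply Series_ext. intros n. unfold sum_lt. rewrite !sum_n_S, sum_n_0. pose proof (pos_INR n).
    unfold mod6_term.
    rewrite !S_INR, !plus_INR, !mult_INR. simpl INR.
    apply (f_equal2 Rplus); field; lra. }
  assert (E4 : z * / 4 = z2 + z4 + z * / 36).
  { assert (Hg := is_series_scal_r (/ 4) _ _ Hz).
    apply (is_series_group _ _ 3 ltac:(lia)) in Hg.
    assert (Hs := is_series_plus_R _ _ _ _ (is_series_plus_R _ _ _ _ H2 H4) H6).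
    apply is_series_unique in Hg. apply is_series_unique in Hs.
    rewrite <- Hg. rewrite <- Hs.
    apply Series_ext. intros n. unfold sum_lt. rewrite !sum_n_S, sum_n_0. pose proof (pos_INR n).
    unfold mod6_term.
    rewrite !S_INR, !plus_INR, !mult_INR. simpl INR.
    repeat apply (f_equal2 Rplus); field; lra. }
  assert (E5 : K = 4 / 9 * z + 2 * z2 - 2 * z5) by lra.
  rewrite E5. unfold z, z2, z5. field.
Qed.

(** * From the series to the integral *)

Lemma harmonic_S (n : nat) : harmonic (S n) = harmonic n + / INR (S n).
Proof. apply sum_lt_S. Qed.

(** By [1 / (n+1) <= 2 (sqrt (n+1) - sqrt n)]. Any growth slower than [n] suffices, as the bound is
    later divided by [N + 2]. *)
Lemma harmonic_bounds (n : nat) : 0 <= harmonic n <= 2 * sqrt (INR n).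
Proof.
  induction n as [|n IH].
  - unfold harmonic. simpl. rewrite sqrt_0. lra.
  - rewrite harmonic_S, S_INR. pose proof (pos_INR n).
    set (a := sqrt (INR n)) in *. set (b := sqrt (INR n + 1)).
    assert (Ha : a * a = INR n) by (apply sqrt_sqrt; lra).
    assert (Hb : b * b = INR n + 1) by (apply sqrt_sqrt; lra).
    assert (0 <= a) by apply sqrt_pos.
    assert (a <= b) by (apply sqrt_le_1; lra).
    assert (1 <= b) by (rewrite <- sqrt_1; apply sqrt_le_1; lra).
    rewrite <- Hb.
    assert (0 < / (b * b)) by (apply Rinv_0_lt_compat; nra).
    split; [lra|].
    assert (/ (b * b) <= 2 * b - 2 * a); [|lra].
    apply (Rmult_le_reg_l (b * b)); [nra|]. rewrite Rinv_r by nra.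
    assert ((b - a) * (b + a) = 1) by nra.
    assert (b * b * (b - a) * 2 >= (b + a) * (b - a)); [|nra].
    assert (b * b * 2 >= b + a) by nra. nra.
Qed.

(* Multiplying the truncated generating function of the harmonic numbers by [1 + y]
   telescopes it to the Taylor polynomial of [ln (1 + y)] plus one boundary term. *)
Lemma harmonic_generating (y : R) (N : nat) :
  (1 + y) * sum_n (fun j => (-1) ^ (S j + 1) * harmonic (S j) * y ^ S j) N =
  sum_n (fun j => (-1) ^ j * y ^ S j / INR (S j)) N + (-1) ^ N * harmonic (S N) * y ^ (N + 2).
Proof.
  assert (Hs : forall j, (-1) ^ (S j + 1) = (-1) ^ j) by (intros; rewrite pow_add; simpl; ring).
  induction N as [|N IH].
  - rewrite !sum_n_0, Hs, harmonic_S. unfold harmonic. simpl. field.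
  - rewrite !sum_n_S, Rmult_plus_distr_l, IH, Hs.
    rewrite (harmonic_S (S N)). replace (S N + 2)%nat with (S (N + 2)) by lia.
    replace (S (S N)) with (N + 2)%nat by lia.
    rewrite <- !tech_pow_Rmult. field. apply not_0_INR. lia.
Qed.

Lemma ln_taylor_bound (y : R) (N : nat) : 0 <= y <= 1 ->
  Rabs (sum_n (fun j => (-1) ^ j * y ^ S j / INR (S j)) N - ln (1 + y)) <= y ^ (N + 2).
Proof.
  intros Hy.
  set (D := fun y => sum_n (fun j => (-1) ^ j * y ^ S j / INR (S j)) N - ln (1 + y)).
  assert (Hgeo : forall x, 0 <= x -> sum_n (fun j => (-1) ^ j * x ^ j) N - / (1 + x) = (-1) ^ N * x ^ S N * / (1 + x)).
  { intros x Hx. induction N as [|n IH].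
    - rewrite sum_n_0. simpl. field. lra.
    - rewrite sum_n_S.
      replace (sum_n (fun j => (-1) ^ j * x ^ j) n + (-1) ^ S n * x ^ S n - / (1 + x))
        with ((sum_n (fun j => (-1) ^ j * x ^ j) n - / (1 + x)) + (-1) ^ S n * x ^ S n) by ring.
      rewrite IH. rewrite <- !tech_pow_Rmult. field. lra. }
  assert (Hd : forall x, 0 <= x -> is_derive D x ((-1) ^ N * x ^ S N * / (1 + x))).
  { intros x Hx. rewrite <- Hgeo by auto.
    apply (is_derive_minus (fun y => sum_n (fun j => (-1) ^ j * y ^ S j / INR (S j)) N) (fun y => ln (1 + y))).
    - apply (is_derive_sum_n (fun j y => (-1) ^ j * y ^ S j / INR (S j)) N x (fun j => (-1) ^ j * x ^ j)).
      intros j _. assert (INR (S j) <> 0) by (apply not_0_INR; lia).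
      evar_last.
      + apply (is_derive_ext (fun y => (-1) ^ j / INR (S j) * y ^ S j)).
        * intros; simpl; field. auto.
        * apply is_derive_scal, is_derive_pow, is_derive_id.
      + change ((-1) ^ j / INR (S j) * (INR (S j) * 1 * x ^ j) = (-1) ^ j * x ^ j). field. auto.
    - auto_derive. lra. field. lra. }
  destruct (MVT_gen D 0 y (fun x => (-1) ^ N * x ^ S N * / (1 + x))) as (c & Hc & E).
  - intros x Hx. rewrite Rmin_left, Rmax_right in Hx by lra. apply Hd; lra.
  - intros x Hx. rewrite Rmin_left, Rmax_right in Hx by lra.
    apply continuity_pt_filterlim, (ex_derive_continuous D). eexists. apply Hd; lra.
  - rewrite Rmin_left, Rmax_right in Hc by lra.
    assert (D0 : D 0 = 0).
    { unfold D. rewrite Rplus_0_r, ln_1, Rminus_0_r. clear.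
      assert (Ht : forall j, (-1) ^ j * 0 ^ S j / INR (S j) = 0) by (intros; simpl; unfold Rdiv; ring).
      induction N as [|n IH]; [rewrite sum_n_0|rewrite sum_n_S, IH]; rewrite Ht; ring. }
    fold (D y). replace (D y) with (D y - D 0) by (rewrite D0; ring). rewrite E, Rminus_0_r.
    rewrite !Rabs_mult, pow_1_abs, Rmult_1_l.
    assert (0 <= c ^ S N) by (apply pow_le; lra).
    assert (c ^ S N <= y ^ S N) by (apply pow_incr; lra).
    assert (0 < / (1 + c) <= 1).
    { split; [apply Rinv_0_lt_compat; lra|]. rewrite <- Rinv_1. apply Rinv_le_contravar; lra. }
    rewrite !Rabs_pos_eq by lra.
    replace (N + 2)%nat with (S N + 1)%nat by lia. rewrite pow_add, pow_1.
    apply Rmult_le_compat_r; [lra|]. nra.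
Qed.

(** Oddness of [m] gives the boundary term of the geometric sum a plus sign; the resulting
    [1 + x^(3m)] is the factor that telescopes the harmonic generating function. *)
Lemma alternating_geometric (m : nat) (x : R) : Nat.Odd m ->
  sum_lt (fun p => (-1) ^ p * (x ^ (3 * p) + x ^ (3 * p + 1))) m = (1 + x ^ (3 * m)) * / cyclo6 x.
Proof.
  intros [d ->]. replace (2 * d + 1)%nat with (S (2 * d)) by lia.
  change (sum_lt ?f (S (2 * d))) with (sum_n f (2 * d)).
  rewrite inv_cyclo6_geometric, pow_1_odd. ring.
Qed.

Lemma is_RInt_sum_lt (f : nat -> R -> R) (l : nat -> R) (a b : R) (N : nat) :
  (forall n, (n < N)%nat -> is_RInt (f n) a b (l n)) ->
  is_RInt (fun x => sum_lt (fun n => f n x) N) a b (sum_lt l N).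
Proof.
  destruct N as [|N]; intros H.
  - pose proof (is_RInt_const (V := R_NormedModule) a b 0) as H0.
    change (scal (b - a) 0) with ((b - a) * 0) in H0. now rewrite Rmult_0_r in H0.
  - apply is_RInt_sum_n. intros n Hn. apply H. lia.
Qed.

Definition series_term (m n : nat) : R :=
  (-1) ^ (n + 1) * harmonic n *
  sum_lt (fun p => (-1) ^ p / (3 * INR m * INR n + 3 * INR p + 1) +
                   (-1) ^ p / (3 * INR m * INR n + 3 * INR p + 2)) m.

Lemma is_RInt_series_term (m n : nat) : Nat.Odd m ->
  is_RInt (fun x => (-1) ^ (n + 1) * harmonic n * (x ^ (3 * m)) ^ n * ((1 + x ^ (3 * m)) * / cyclo6 x)) 0 1
    (series_term m n).
Proof.
  intros Hm.
  apply (is_RInt_ext (fun x => scal ((-1) ^ (n + 1) * harmonic n)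
    (sum_lt (fun p => (-1) ^ p * (x ^ (3 * m * n + 3 * p) + x ^ (3 * m * n + 3 * p + 1))) m))).
  - intros x _. rewrite <- alternating_geometric by auto.
    match goal with |- ?a = ?b => change (@eq R a b) end.
    change (scal ?a ?b) with (a * b).
    rewrite <- pow_mult, (Rmult_assoc (_ * harmonic n)). f_equal.
    assert (E : forall k, sum_lt (fun p => (-1) ^ p * (x ^ (3 * m * n + 3 * p) + x ^ (3 * m * n + 3 * p + 1))) k
      = x ^ (3 * m * n) * sum_lt (fun p => (-1) ^ p * (x ^ (3 * p) + x ^ (3 * p + 1))) k); [|apply E].
    induction k as [|k IH]; [simpl; ring|]. rewrite !sum_lt_S, IH, !pow_add. ring.
  - apply (is_RInt_scal (V := R_NormedModule)), is_RInt_sum_lt. intros p _.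
    assert (E : INR (3 * m * n + 3 * p) = 3 * INR m * INR n + 3 * INR p).
    { rewrite plus_INR, !mult_INR. simpl. ring. }
    assert (H := is_RInt_scal _ _ _ ((-1) ^ p) _
      (is_RInt_plus _ _ _ _ _ _ (is_RInt_pow (3 * m * n + 3 * p)) (is_RInt_pow (3 * m * n + 3 * p + 1)))).
    assert (0 <= INR (3 * m * n + 3 * p)) by apply pos_INR.
    replace ((-1) ^ p / (3 * INR m * INR n + 3 * INR p + 1) + (-1) ^ p / (3 * INR m * INR n + 3 * INR p + 2))
      with ((-1) ^ p * (/ (INR (3 * m * n + 3 * p) + 1) + / (INR (3 * m * n + 3 * p + 1) + 1))); [exact H|].
    rewrite (plus_INR _ 1), E in *. simpl INR. field. lra.
Qed.

Definition log_integrand (m : nat) (x : R) : R := ln (1 + x ^ (3 * m)) * / cyclo6 x.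

Lemma ex_RInt_log_integrand (m : nat) : ex_RInt (log_integrand m) 0 1.
Proof.
  apply ex_RInt_continuous_le; [lra|]. intros x Hx.
  assert (0 <= x ^ (3 * m)) by (apply pow_le; lra).
  apply (continuous_mult (fun x => ln (1 + x ^ (3 * m)))); [|apply continuous_inv_cyclo6].
  apply (ex_derive_continuous (fun x => ln (1 + x ^ (3 * m)))).
  generalize dependent (3 * m)%nat. intros e He. auto_derive. lra.
Qed.

(** Taylor error and boundary term together are at most [(1 + harmonic (S N)) y^(N+2)] with
    [y = x^(3m)]. This does not tend to 0 at [x = 1], but integration supplies a factor of at most
    [1 / (N + 2)]. *)
Lemma series_term_partial_sum (m N : nat) : (1 <= m)%nat -> Nat.Odd m ->
  Rabs (sum_n (fun j => series_term m (S j)) N - RInt (log_integrand m) 0 1) <=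
  4 / 3 * (1 + harmonic (S N)) * / (INR N + 2).
Proof.
  intros Hm1 Hm.
  assert (H1 := is_RInt_minus _ _ _ _ _ _
    (is_RInt_sum_n _ _ 0 1 N (fun n _ => is_RInt_series_term m (S n) Hm))
    (RInt_correct_R _ _ _ (ex_RInt_log_integrand m))).
  assert (H2 := is_RInt_scal _ _ _ (4 / 3 * (1 + harmonic (S N))) _ (is_RInt_pow (3 * m * (N + 2)))).
  pose proof (harmonic_bounds (S N)) as [Hh _].
  assert (Hn := fun H => norm_RInt_le _ _ _ _ _ _ Rle_0_1 H H1 H2).
  match type of Hn with _ -> norm ?l <= ?r =>
    change (norm l) with (Rabs (sum_n (fun j => series_term m (S j)) N - RInt (log_integrand m) 0 1)) in Hn;
    change r with (4 / 3 * (1 + harmonic (S N)) * / (INR (3 * m * (N + 2)) + 1)) in Hn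
  end.
  eapply Rle_trans; [apply Hn|].
  - intros x Hx. cbv beta. clear H1 H2 Hn.
    match goal with |- norm (minus ?a ?b) <= scal ?c ?d => change (Rabs (a - b) <= c * d) end.
    rewrite (pow_mult x (3 * m)). unfold log_integrand.
    assert (Hy : 0 <= x ^ (3 * m) <= 1).
    { split; [apply pow_le; lra|]. rewrite <- (pow1 (3 * m)). apply pow_incr; lra. }
    generalize dependent (x ^ (3 * m)). intros y Hy.
    assert (E : sum_n (fun n => (-1) ^ (S n + 1) * harmonic (S n) * y ^ S n * ((1 + y) * / cyclo6 x)) N =
      (1 + y) * sum_n (fun n => (-1) ^ (S n + 1) * harmonic (S n) * y ^ S n) N * / cyclo6 x :> R).
    { clear. induction N as [|n IH]; [rewrite !sum_n_0; ring|]. rewrite !sum_n_S, IH. ring. }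
    rewrite E, harmonic_generating. clear E.
    pose proof (ln_taylor_bound y N Hy) as Hl. pose proof (cyclo6_inv_bounds x) as HQ.
    set (T := sum_n (fun j => (-1) ^ j * y ^ S j / INR (S j)) N) in *.
    replace ((T + (-1) ^ N * harmonic (S N) * y ^ (N + 2)) * / cyclo6 x - ln (1 + y) * / cyclo6 x)
      with (((T - ln (1 + y)) + (-1) ^ N * (harmonic (S N) * y ^ (N + 2))) * / cyclo6 x) by ring.
    assert (0 <= y ^ (N + 2)) by (apply pow_le; lra).
    rewrite Rabs_mult, (Rabs_pos_eq (/ cyclo6 x)) by lra.
    assert (Hr : Rabs (T - ln (1 + y) + (-1) ^ N * (harmonic (S N) * y ^ (N + 2))) <= (1 + harmonic (S N)) * y ^ (N + 2)).
    { eapply Rle_trans; [apply Rabs_triang|]. rewrite (Rabs_mult _ (harmonic (S N) * _)), pow_1_abs, (Rabs_pos_eq (harmonic (S N) * _)) by nra. lra. }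
    assert (0 <= (1 + harmonic (S N)) * y ^ (N + 2)) by nra.
    replace (4 / 3 * (1 + harmonic (S N)) * y ^ (N + 2)) with ((1 + harmonic (S N)) * y ^ (N + 2) * (4 / 3)) by ring.
    apply Rmult_le_compat; try lra. apply Rabs_pos.
  - apply Rmult_le_compat_l; [lra|]. pose proof (pos_INR N).
    apply Rinv_le_contravar; [lra|].
    assert (INR N + 2 <= INR (3 * m * (N + 2))); [|lra].
    replace (INR N + 2) with (INR (N + 2)) by (rewrite plus_INR; reflexivity).
    apply le_INR. nia.
Qed.

Lemma is_series_log_integral (m : nat) : (1 <= m)%nat -> Nat.Odd m ->
  is_series (fun j => series_term m (S j)) (RInt (log_integrand m) 0 1).
Proof.
  intros Hm1 Hm. apply is_lim_seq_sum_n.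
  set (l := RInt (log_integrand m) 0 1).
  apply (is_lim_seq_ext (fun N => l + (sum_n (fun j => series_term m (S j)) N - l))).
  { intros N. ring. }
  replace (Finite l) with (Finite (l + 0)) by (f_equal; ring).
  apply is_lim_seq_plus'; [apply is_lim_seq_const|].
  apply is_lim_seq_abs_0.
  apply is_lim_seq_le_le with (fun _ => 0) (fun N => 4 * sqrt (/ (1 * INR N + 2))).
  - intros N. split; [apply Rabs_pos|].
    eapply Rle_trans; [apply series_term_partial_sum; auto|].
    pose proof (pos_INR N). destruct (harmonic_bounds (S N)) as [_ Hh].
    rewrite Rmult_1_l, sqrt_inv.
    rewrite S_INR in Hh.
    assert (Hs : sqrt (INR N + 1) <= sqrt (INR N + 2)) by (apply sqrt_le_1; lra).
    assert (H1 : 1 <= sqrt (INR N + 2)) by (rewrite <- sqrt_1; apply sqrt_le_1; lra).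
    assert (Hss : sqrt (INR N + 2) * sqrt (INR N + 2) = INR N + 2) by (apply sqrt_sqrt; lra).
    rewrite <- Hss at 1. set (s := sqrt (INR N + 2)) in *.
    (* From [1 <= s] and [harmonic (S N) <= 2 s], the factor [1 + harmonic (S N)] is at most
       [3 s]. *)
    replace (4 * / s) with (4 / 3 * (3 * s) * / (s * s)) by (field; lra).
    apply Rmult_le_compat_r; [apply Rlt_le, Rinv_0_lt_compat; nra|]. lra.
  - apply is_lim_seq_const.
  - replace (Finite 0) with (Finite (4 * sqrt 0)) by (f_equal; rewrite sqrt_0; ring).
    apply (is_lim_seq_scal_l _ 4 (sqrt 0)). apply is_lim_seq_continuous.
    + apply continuity_pt_sqrt. lra.
    + apply is_lim_seq_inv_linear. lra.
Qed.

(** * Evaluation of the logarithmic integral and of the bracket *)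

Lemma triple_integral_0 : triple_integral 0 = radial_integral 1.
Proof.
  pose proof PI_RGT_0.
  rewrite <- (is_RInt_unique _ _ _ _ (is_RInt_triple 0 ltac:(lra))).
  apply RInt_ext. intros x _. f_equal. f_equal. unfold radial. rewrite Rmult_0_r, cos_0. ring.
Qed.

(** The [t] for which [2 cos (3 t)] is the middle coefficient [- 2 phi_k]; the supplement of the
    angle of [phi_k] puts it in [(0, PI / 3)]. *)
Definition third_angle (m k : nat) : R := (PI - (2 * INR k + 1) * PI / INR m) / 3.

Lemma third_angle_bounds (m k : nat) : (1 <= m)%nat -> (2 * k + 1 < m)%nat ->
  0 < third_angle m k < PI / 3.
Proof. intros Hm Hk. pose proof (phi_angle m k Hm Hk). unfold third_angle. lra. Qed.

Lemma cos_third_angle (m k : nat) : cos (3 * third_angle m k) = - phi m k.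
Proof.
  unfold third_angle, phi. generalize ((2 * INR k + 1) * PI / INR m). intros a.
  replace (3 * ((PI - a) / 3)) with (PI - a) by field.
  apply Rtrigo_facts.cos_pi_minus.
Qed.

(** The factor [1 + y] of [1 + y^m], [y = x^3], has [radial 1 x] for its square, whence the half. *)
Lemma log_integral_value (d : nat) :
  RInt (log_integrand (2 * d + 1)) 0 1 =
  radial_integral 1 / 2 + sum_lt (fun k => triple_integral (third_angle (2 * d + 1) k)) d.
Proof.
  apply is_RInt_unique.
  assert (Hr : is_RInt (fun x => ln (radial 1 x) * / cyclo6 x) 0 1 (radial_integral 1)).
  { apply RInt_correct_R. apply (ex_RInt_ext (fun x => ln (x ^ 6 + 2 * cos (3 * 0) * x ^ 3 + 1) * / cyclo6 x)).
    - intros x _. f_equal. f_equal. unfold radial. rewrite Rmult_0_r, cos_0. ring.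
    - pose proof PI_RGT_0. eexists. apply (is_RInt_triple 0). lra. }
  assert (Hb : forall k, (k < d)%nat -> 0 <= third_angle (2 * d + 1) k < PI / 3).
  { intros k Hk. pose proof (third_angle_bounds (2 * d + 1) k ltac:(lia) ltac:(lia)). lra. }
  assert (Hs := is_RInt_sum_lt _ _ 0 1 d (fun k Hk => is_RInt_triple _ (Hb k Hk))).
  assert (Ht := is_RInt_plus _ _ _ _ _ _ (is_RInt_scal _ _ _ (/ 2) _ Hr) Hs).
  replace (radial_integral 1 / 2) with (/ 2 * radial_integral 1) by field.
  eapply is_RInt_ext; [|exact Ht].
  intros x Hx. rewrite Rmin_left, Rmax_right in Hx by lra. clear Hr Hs Ht. cbv beta.
  match goal with |- plus (scal ?a ?b) ?c = ?e => change (a * b + c = e) end.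
  unfold log_integrand. rewrite pow_mult. assert (Hy : 0 < x ^ 3) by (apply pow_lt; lra).
  rewrite one_plus_pow_factor by lra.
  assert (Hpos : forall k, (k < d)%nat -> 0 < (x ^ 3) ^ 2 - 2 * phi (2 * d + 1) k * x ^ 3 + 1).
  { intros k Hk. destruct (third_angle_bounds (2 * d + 1) k ltac:(lia) ltac:(lia)).
    replace ((x ^ 3) ^ 2 - 2 * phi (2 * d + 1) k * x ^ 3 + 1) with (quad (3 * third_angle (2 * d + 1) k) (x ^ 3)).
    - apply quad_pos; [lra|]. rewrite <- cos_PI. apply cos_decreasing_1; lra.
    - unfold quad. rewrite cos_third_angle. ring. }
  rewrite ln_mult by (try apply prod_lt_pos; auto; lra).
  rewrite ln_prod_lt by auto.
  replace (radial 1 x) with ((1 + x ^ 3) * (1 + x ^ 3)) by (unfold radial; ring).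
  rewrite (ln_mult (1 + x ^ 3) (1 + x ^ 3)) by lra.
  assert (E : forall n, sum_lt (fun k => ln (x ^ 6 + 2 * cos (3 * third_angle (2 * d + 1) k) * x ^ 3 + 1) * / cyclo6 x) n =
    sum_lt (fun k => ln ((x ^ 3) ^ 2 - 2 * phi (2 * d + 1) k * x ^ 3 + 1)) n * / cyclo6 x).
  { induction n as [|n IH]; [simpl; ring|]. rewrite !sum_lt_S, IH, Rmult_plus_distr_r.
    do 3 f_equal. rewrite cos_third_angle. ring. }
  rewrite E. generalize (/ cyclo6 x). intros q. field.
Qed.

(** With [t] the third angle, [(1 + phi_k) / 2] is the square of [sin (3 t / 2)], and [3 t / 2] lies
    in [(0, PI / 2)], where root and arcsine undo the square and the sine. *)
Lemma asin_sqrt_phi (m k : nat) : (1 <= m)%nat -> (2 * k + 1 < m)%nat ->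
  asin (sqrt ((1 + phi m k) / 2)) = 3 * third_angle m k / 2.
Proof.
  intros Hm Hk. pose proof (third_angle_bounds m k Hm Hk) as Ht.
  set (s := 3 * third_angle m k / 2) in *.
  assert (E : (1 + phi m k) / 2 = sin s * sin s).
  { replace (phi m k) with (- cos (3 * third_angle m k)) by (rewrite cos_third_angle; ring).
    replace (3 * third_angle m k) with (2 * s) by (unfold s; field). rewrite cos_2a_sin. field. }
  assert (Hs : 0 < s < PI / 2) by (unfold s; lra).
  rewrite E, sqrt_square by (apply sin_ge_0; lra). apply asin_sin; lra.
Qed.

(** [1 + phi_k = 2 sin^2 (3 t / 2)] and [sin (3 t / 2) = sin (t / 2) (1 + 2 cos t)], so the
    logarithms of [sin (t / 2)] cancel. *)
Lemma bracket_term (m k : nat) : (1 <= m)%nat -> (2 * k + 1 < m)%nat ->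
  2 * ln (sin (1 / 3 * asin (sqrt ((phi m k + 1) / 2))))
  - ln (2 * cos (2 / 3 * asin (sqrt ((1 + phi m k) / 2))) + 1)
  - ln (1 + phi m k)
  = - 3 * ln (1 + 2 * cos (third_angle m k)) - ln 2.
Proof.
  intros Hm Hk. rewrite (Rplus_comm (phi m k) 1), asin_sqrt_phi by auto.
  pose proof (third_angle_bounds m k Hm Hk) as Ht.
  assert (E : 1 + phi m k = 1 - cos (3 * third_angle m k)) by (rewrite cos_third_angle; ring).
  rewrite E. clear E. set (t := third_angle m k) in *.
  replace (1 / 3 * (3 * t / 2)) with (t / 2) by field.
  replace (2 / 3 * (3 * t / 2)) with t by field.
  assert (Hs : 0 < sin (t / 2)) by (apply sin_gt_0; lra).
  pose proof (cos_gt_half t ltac:(lra)) as Hc.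
  replace (1 - cos (3 * t)) with (2 * ((sin (t / 2) * (1 + 2 * cos t)) * (sin (t / 2) * (1 + 2 * cos t)))).
  - rewrite !ln_mult by (repeat apply Rmult_lt_0_compat; lra).
    rewrite (Rplus_comm (2 * cos t) 1). ring.
  - assert (E : sin (t / 2) * (1 + 2 * cos t) = sin (3 * t / 2)).
    { replace (3 * t / 2) with (t + t / 2) by field. rewrite sin_plus.
      replace (sin t) with (2 * sin (t / 2) * cos (t / 2)) by (rewrite <- sin_2a; f_equal; field).
      replace (cos t) with (2 * cos (t / 2) * cos (t / 2) - 1) by (rewrite <- cos_2a_cos; f_equal; field). ring. }
    rewrite E. replace (cos (3 * t)) with (1 - 2 * sin (3 * t / 2) * sin (3 * t / 2)); [ring|].
    rewrite <- cos_2a_sin. f_equal. field.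
Qed.

Theorem theorem3p2 (m : nat) (hm1 : (1 <= m)%nat) (hm : Nat.Odd m) :
  is_series_from1
    (fun n : nat =>
       (-1) ^ (n + 1) * harmonic n *
       sum_lt (fun p : nat =>
                 (-1) ^ p / (3 * INR m * INR n + 3 * INR p + 1) +
                 (-1) ^ p / (3 * INR m * INR n + 3 * INR p + 2)) m)
    (INR m / 12 * (trigamma (5 / 6) - trigamma (1 / 3))
     - PI ^ 2 * INR m / 9
     + PI * sqrt 3 / 3 * ln 3
     - PI * (INR m - 1) * sqrt 3 / 9 * ln 2
     - 2 * PI * sqrt 3 / 9 *
       (2 * sum_lt (fun k : nat =>
                      ln (sin (1 / 3 * asin (sqrt ((phi m k + 1) / 2)))))
              ((m - 1) / 2)
        - sum_lt (fun k : nat =>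
                    ln (2 * cos (2 / 3 * asin (sqrt ((1 + phi m k) / 2))) + 1))
            ((m - 1) / 2)
        - sum_lt (fun k : nat => ln (1 + phi m k)) ((m - 1) / 2))).
Proof.
  destruct hm as [d Hd].
  assert (Hd2 : ((m - 1) / 2 = d)%nat).
  { subst m. replace (2 * d + 1 - 1)%nat with (d * 2)%nat by lia. apply Nat.div_mul. lia. }
  rewrite Hd2.
  assert (Hbr : forall n, (n <= d)%nat ->
    2 * sum_lt (fun k => ln (sin (1 / 3 * asin (sqrt ((phi m k + 1) / 2))))) n
    - sum_lt (fun k => ln (2 * cos (2 / 3 * asin (sqrt ((1 + phi m k) / 2))) + 1)) n
    - sum_lt (fun k => ln (1 + phi m k)) n
    = - 3 * sum_lt (fun k => ln (1 + 2 * cos (third_angle m k))) n - INR n * ln 2).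
  { induction n as [|n IH]; intros Hn; [simpl; ring|].
    rewrite !sum_lt_S, S_INR. pose proof (bracket_term m n hm1 ltac:(lia)).
    specialize (IH ltac:(lia)). lra. }
  assert (Htr : forall n, (n <= d)%nat -> sum_lt (fun k => triple_integral (third_angle m k)) n =
    INR n * (radial_integral 1 - 3 * c1 * ln 3) + 3 * c1 * sum_lt (fun k => ln (1 + 2 * cos (third_angle m k))) n).
  { induction n as [|n IH]; intros Hn; [simpl; ring|].
    rewrite !sum_lt_S, S_INR, IH by lia.
    pose proof (third_angle_bounds m n hm1 ltac:(lia)).
    rewrite triple_integral_value, triple_integral_0 by lra. ring. }
  match goal with |- is_series_from1 _ ?l => replace l with (RInt (log_integrand m) 0 1) end.
  { apply is_series_log_integral; [auto|now exists d]. }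
  assert (Hm : INR m = 2 * INR d + 1) by (subst m; rewrite plus_INR, mult_INR; reflexivity).
  rewrite (Hbr d), Hd, log_integral_value, <- Hd, (Htr d), Hm by lia.
  pose proof (kappa_value _ is_series_kappa) as HK.
  (* The parenthesis is the sum [K]. In the end the multiples of [ln 2] inside and outside the
     bracket cancel, as [c1 d = PI (m - 1) sqrt 3 / 9]. *)
  replace (radial_integral 1) with (3 * c1 * ln 3 - 3 * (c1 * ln 3 - radial_integral 1 / 3)) by field.
  rewrite HK. unfold c1. match goal with |- ?a = ?b => change (@eq R a b) end. field.
Qed.
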